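(* Let $X$ be a germ of analytic vector field vanishing at the origin of $\mathbb R^2$ (resp. of $\mathbb C^2$). Assume that its linear part is not radial. Then there exist local analytic coordinates $(x,y)$ at the origin in which $$X=(y+f(x))\,\partial_x+g(x)\,\partial_y$$ where $f,g\in\mathbb R\{x\}$ (resp. $f,g\in\mathbb C\{x\}$) vanish at $0$.
   Context: $\mathbb R\{x\}$ and $\mathbb C\{x\}$ denote the rings of convergent power series in one variable with real, resp. complex, coefficients. In the real case, analytic means real analytic, and coordinates are real analytic; in the complex case analytic means holomorphic. The linear part of $X$ at $0$ is not radial if its matrix is not of the form $\lambda I$ for any scalar $\lambda$; in particular it is not the zero matrix. *)

(* Defs.v *)
From HB Require Import structures.
From mathcomp Require Import all_boot all_order all_algebra finmap.
From mathcomp Require Import all_classical all_reals all_analysis.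
From mathcomp Require Import summability.
From mathcomp Require Export complex.

Set Implicit Arguments.
Unset Strict Implicit.
Unset Printing Implicit Defensive.

Import Order.TTheory GRing.Theory Num.Theory.
Import numFieldNormedType.Exports.

Local Open Scope classical_set_scope.
Local Open Scope ring_scope.

(* Everything is stated over a numFieldType K and is meant for K = R and
   K = R[i] with R a realType.  A germ at the origin is given by any of its
   representatives, taken to be a total function: only its values near 0
   matter. *)
Section germs.
Variable K : numFieldType.
Implicit Types (f g : K -> K) (h : 'rV[K]_2 -> K).
Implicit Types (X Phi Psi : 'rV[K]_2 -> 'rV[K]_2).

Definition cx (p : 'rV[K]_2) : K := p ord0 ord0.
Definition cy (p : 'rV[K]_2) : K := p ord0 ord_max.

Definition analytic_germ1 f : Prop :=
  exists a : nat -> K, \forall x \near (0 : K),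
    series (fun n => a n * x ^+ n) @ \oo --> f x.

(* The double series is summed unconditionally, i.e. along the finite subsets
   of nat * nat ordered by inclusion; over R and R[i] this is absolute
   convergence. *)
Definition analytic_germ2 h : Prop :=
  exists a : nat * nat -> K, \forall p \near (0 : 'rV[K]_2),
    partial_sum (fun k => a k * (cx p ^+ k.1 * cy p ^+ k.2)) @ totally --> h p.

Definition analytic_map_germ X : Prop :=
  analytic_germ2 (cx \o X) /\ analytic_germ2 (cy \o X).

(* Germs of analytic diffeomorphisms of (K^2, 0). *)
Definition local_analytic_coordinates Phi : Prop :=
  [/\ Phi 0 = 0, analytic_map_germ Phi &
      exists Psi, [/\ Psi 0 = 0, analytic_map_germ Psi,
        \forall p \near (0 : 'rV[K]_2), Psi (Phi p) = p &
        \forall q \near (0 : 'rV[K]_2), Phi (Psi q) = q]].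

(* The Jacobian matrix acts on row vectors, so it is the transpose of the usual
   matrix of the linear part; being scalar is insensitive to this. *)
Definition radial_linear_part X : Prop :=
  exists lambda : K, 'J X 0 = lambda%:M.

(* A vector field X, seen as a derivation, sends h to p |-> 'D_(X p) h p.  It is
   equal to A(x, y) d/dx + B(x, y) d/dy in coordinates (x, y) iff it sends x to
   A(x, y) and y to B(x, y). *)
Definition vf_in_coordinates X Phi (A B : K -> K -> K) : Prop :=
  let x := cx \o Phi in let y := cy \o Phi in
  \forall p \near (0 : 'rV[K]_2),
    'D_(X p) x p = A (x p) (y p) /\ 'D_(X p) y p = B (x p) (y p).

Definition has_normal_form X : Prop :=
  exists Phi f g,
    [/\ local_analytic_coordinates Phi,
        analytic_germ1 f /\ f 0 = 0,
        analytic_germ1 g /\ g 0 = 0 &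
        vf_in_coordinates X Phi (fun x y => y + f x) (fun x _ => g x)].

End germs.

(* Main.v *)
From mathcomp Require Import all_boot all_order all_algebra finmap.
From mathcomp Require Import all_classical all_reals all_analysis.
From mathcomp Require Import summability.
From mathcomp Require Import ring lra zify.
Require Import Defs.

(** The chart is sought from the source side: an unknown map gamma(u, v) of the
    plane, with two unknown functions f(u) and g(u), such that
      (v + f(u)) gamma_u + g(u) gamma_v = X(gamma).
    For a fixed u this equation says two things. The curve v |-> gamma(u, v) is
    tangent to X at the parameter v = - f(u), with ratio g(u): where this
    tangency is simple, the curve determines both numbers. Moreover gamma_u is the
    quotient of X(gamma) - g gamma_v by v + f(u). Hence the whole system is an
    evolution equation in the time u for a curve, of Cauchy-Kovalevskaya type: the
    right-hand side loses one derivative in v and is otherwise bounded, the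
    division being nonlocal in v but local in u. The hypothesis on the linear part
    A provides the initial curve: the line spanned by a vector e that is not an
    eigenvector. In the basis (A e, e) the components of X are y + H1 and H2, where
    H1 and H2 have neither a constant term nor a term in y; the tangency is simple
    at 0, and gamma_u(0, 0) = A e is independent from gamma_v(0, 0) = e, so that
    gamma is a chart.

    The division by v + f(u) is eliminated as follows. Let S a be
    (a(u, v) - a(u, 0)) / v and let I be the integration in u from 0. Writing
      gamma = (u + I S P, v + I S Q),  f(u) = P(u, 0),  g(u) = Q(u, 0),
    the equation becomes a fixed point equation for the pair of series (P, Q),
      P = I S Q + H1(gamma) - Q(u, 0) d_v I S P - P(u, 0) S P,
      Q = H2(gamma) - Q(u, 0) d_v I S Q - P(u, 0) S Q,
    whose right-hand side is [normalizing_step]; [normalizing_data_pde] goes back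
    from its solutions to the equation for gamma.

    Convergence comes from an l1 norm on double series with the weights
      tau^i s^j sup_(1/2 <= rho <= 1) rho^j (1 - rho)^i.
    They are submultiplicative, they make S bounded because rho >= 1/2, and the
    integration in u compensates a derivative in v ([nagumo_derivative]), as for the
    norms of Nagumo. For s small, and then tau small with respect to s, the right-hand
    side preserves a ball ([normalizing_solution]). It is also causal: each of its
    coefficients depends on coefficients of smaller rank ([causal_fixpoint]). The
    iterates therefore stabilize coefficient by coefficient, and their limit is a
    solution that remains in the ball.

    The map gamma is tangent to the identity and the same method inverts it
    ([two_sided_inverse]); differentiating Phi o gamma = id along the normal form
    shows that the inverse Phi carries X to it ([prepared_normal_form]). A linear
    change of coordinates reduces the general case to this one ([normal_form]). All
    this takes place over a field with a complete real-valued absolute value, which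
    covers R and R[i] at once. *)

Set Implicit Arguments.
Unset Strict Implicit.
Unset Printing Implicit Defensive.
Import Order.TTheory GRing.Theory Num.Theory.
Import numFieldNormedType.Exports.
Local Open Scope classical_set_scope.
Local Open Scope ring_scope.

(** * Sums over squares of indices *)

Definition square_sum (V : nmodType) (n : nat) (f : nat -> nat -> V) : V :=
  \sum_(i < n) \sum_(j < n) f i j.

Definition cauchy_prod (A : pzRingType) (f g : nat -> nat -> A) i j : A :=
  \sum_(k < i.+1) \sum_(l < j.+1) f k l * g (i - k)%N (j - l)%N.

Lemma eq_square_sum (V : nmodType) n (f g : nat -> nat -> V) :
  (forall i j, (i < n)%N -> (j < n)%N -> f i j = g i j) ->
  square_sum n f = square_sum n g.
Proof.
by move=> fg; apply: eq_bigr => i _; apply: eq_bigr => j _; exact: fg.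
Qed.

Lemma square_sumD (V : nmodType) n (f g : nat -> nat -> V) :
  square_sum n (fun i j => f i j + g i j) = square_sum n f + square_sum n g.
Proof.
by rewrite /square_sum -big_split; apply: eq_bigr => i _; rewrite big_split.
Qed.

Lemma square_sumN (V : zmodType) n (f : nat -> nat -> V) :
  square_sum n (fun i j => - f i j) = - square_sum n f.
Proof.
by rewrite /square_sum -sumrN; apply: eq_bigr => i _; rewrite sumrN.
Qed.

Lemma square_sumMr (A : pzRingType) n (f : nat -> nat -> A) c :
  square_sum n (fun i j => f i j * c) = square_sum n f * c.
Proof.
by rewrite /square_sum mulr_suml; apply: eq_bigr => i _; rewrite mulr_suml.
Qed.

Lemma square_sumMl (A : pzRingType) n (f : nat -> nat -> A) c :
  square_sum n (fun i j => c * f i j) = c * square_sum n f.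
Proof.
by rewrite /square_sum mulr_sumr; apply: eq_bigr => i _; rewrite mulr_sumr.
Qed.

Lemma square_sum0 (V : nmodType) n : square_sum n (fun _ _ => 0 : V) = 0.
Proof. by rewrite /square_sum big1 // => i _; rewrite big1. Qed.

Lemma square_sum_exchange (V : nmodType) m n (f : nat -> nat -> nat -> nat -> V) :
  square_sum m (fun i j => square_sum n (f i j)) =
  square_sum n (fun k l => square_sum m (fun i j => f i j k l)).
Proof.
rewrite /square_sum.
under eq_bigr do rewrite exchange_big /=.
rewrite exchange_big /=; apply: eq_bigr => k _.
under eq_bigr do rewrite exchange_big /=.
by rewrite exchange_big.
Qed.

Section real_square_sum.
Variable R : realType.
Implicit Types f g : nat -> nat -> R.

Lemma le_square_sum n f g : (forall i j, f i j <= g i j) ->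
  square_sum n f <= square_sum n g.
Proof. by move=> fg; apply: ler_sum => i _; apply: ler_sum => j _. Qed.

Lemma square_sum_ge0 n f : (forall i j, 0 <= f i j) -> 0 <= square_sum n f.
Proof. by move=> f0; apply: sumr_ge0 => i _; apply: sumr_ge0 => j _. Qed.

Lemma sum_ord_le m n (f : nat -> R) : (forall i, 0 <= f i) -> (m <= n)%N ->
  \sum_(i < m) f i <= \sum_(i < n) f i.
Proof.
move=> f0 mn; rewrite -(subnKC mn) big_split_ord /= lerDl.
by apply: sumr_ge0.
Qed.

Lemma square_sum_le m n f : (forall i j, 0 <= f i j) -> (m <= n)%N ->
  square_sum m f <= square_sum n f.
Proof.
move=> f0 mn; apply: (@le_trans _ _ (\sum_(i < m) \sum_(j < n) f i j)).
  by apply: ler_sum => i _; apply: (sum_ord_le (f := f i)).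
apply: (sum_ord_le (f := fun i => \sum_(j < n) f i j)) => // i.
by apply: sumr_ge0.
Qed.

Lemma bounded_increasing_cvg (u : nat -> R) M :
  (forall m n, (m <= n)%N -> u m <= u n) -> (forall n, u n <= M) ->
  exists2 l, (forall n, u n <= l) & forall e, 0 < e ->
    exists n0, forall n, (n0 <= n)%N -> l - e <= u n.
Proof.
move=> u_mono uM; exists (sup (range u)) => [n|e e0].
  by apply: ub_le_sup; [exists M => _ [k _ <-]|exists n].
have [|_ [n0 _ <-] /ltW le_n0] := @sup_adherent _ (range u) _ e0.
  by split; [exists (u 0%N), 0%N | exists M => _ [k _ <-]].
by exists n0 => n n0n; apply: le_trans (u_mono _ _ n0n).
Qed.

End real_square_sum.

Lemma sum_antidiagonal (V : nmodType) n (F : nat -> nat -> V) :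
  \sum_(i < n) \sum_(k < i.+1) F k (i - k)%N =
  \sum_(k < n) \sum_(l < n) if (k + l < n)%N then F k l else 0.
Proof.
elim: n => [|n IHn]; first by rewrite !big_ord0.
rewrite big_ord_recr /= IHn [in RHS]big_ord_recr /=.
rewrite [X in _ = _ + X]big_ord_recl /= addn0 ltnSn.
rewrite [X in _ = _ + (_ + X)]big1 ?addr0; last first.
  by move=> i _; rewrite /= /bump /= add1n addnS ltnS ltnNge leq_addr.
rewrite [X in _ + X = _]big_ord_recr /= subnn addrA; congr (_ + _).
rewrite -big_split /=; apply: eq_bigr => k _.
have kn := ltn_ord k.
transitivity (\sum_(l < n.+1) ((if (k + l < n)%N then F k l else 0) +
                               (if (k + l == n)%N then F k l else 0))).
  rewrite big_split /= [in X in _ = X + _]big_ord_recr /=.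
  rewrite ltnNge leq_addl /= addr0; congr (_ + _).
  have nk : (n - k < n.+1)%N by rewrite ltnS leq_subr.
  rewrite (bigD1 (Ordinal nk)) //= subnKC ?(ltnW kn) // eqxx.
  rewrite big1 ?addr0 // => l; rewrite -val_eqE /=.
  by move=> lnk; case: eqP => // kln; case/eqP: lnk; apply: (@addnI k); rewrite kln subnKC // ltnW.
apply: eq_bigr => l _; rewrite ltnS.
by case: (ltngtP (k + l)%N n) => _; rewrite ?addr0 ?add0r.
Qed.

Lemma square_sum_cauchy_prod (A : pzRingType) n (f g : nat -> nat -> A) :
  square_sum n (cauchy_prod f g) = square_sum n (fun k k' =>
    square_sum n (fun l l' =>
      if ((k + k' < n) && (l + l' < n))%N then f k l * g k' l' else 0)).
Proof.
rewrite /square_sum /cauchy_prod.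
under eq_bigr do rewrite exchange_big /=.
rewrite (sum_antidiagonal n (fun k k' =>
  \sum_(j < n) \sum_(l < j.+1) f k l * g k' (j - l)%N)).
apply: eq_bigr => k _; apply: eq_bigr => k' _.
rewrite (sum_antidiagonal n (fun l l' => f k l * g k' l')).
case: ifP => //= _; last by symmetry; exact: (square_sum0 A n).
Qed.

Lemma square_sum_mul (A : pzRingType) n (f g : nat -> nat -> A) :
  square_sum n f * square_sum n g =
  square_sum n (fun k k' => square_sum n (fun l l' => f k l * g k' l')).
Proof.
rewrite /square_sum mulr_suml; apply: eq_bigr => k _.
rewrite mulr_sumr; apply: eq_bigr => k' _.
by rewrite mulr_suml; apply: eq_bigr => l _; rewrite mulr_sumr.
Qed.

Section real_cauchy_prod.
Variable R : realType.
Variables f g : nat -> nat -> R.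
Hypotheses (f0 : forall i j, 0 <= f i j) (g0 : forall i j, 0 <= g i j).

Lemma cauchy_prod_ge0 i j : 0 <= cauchy_prod f g i j.
Proof. by apply: sumr_ge0 => k _; apply: sumr_ge0 => l _; rewrite mulr_ge0. Qed.

Lemma square_sum_cauchy_prod_le n :
  square_sum n (cauchy_prod f g) <= square_sum n f * square_sum n g.
Proof.
rewrite square_sum_cauchy_prod square_sum_mul.
apply: le_square_sum => k k'; apply: le_square_sum => l l'.
by case: ifP => // _; rewrite mulr_ge0.
Qed.

(** Indices smaller than [n] add up to indices smaller than [2 n]. *)
Lemma square_sum_cauchy_prod_ge n :
  square_sum n f * square_sum n g <= square_sum n.*2 (cauchy_prod f g).
Proof.
rewrite square_sum_cauchy_prod square_sum_mul.
set F := fun m k k' => square_sum m (fun l l' =>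
  if (k + k' < n.*2)%N && (l + l' < n.*2)%N then f k l * g k' l' else 0).
have Fge0 m k k' : 0 <= F m k k'.
  by apply: square_sum_ge0 => l l'; case: ifP => // _; rewrite mulr_ge0.
have n2 : (n <= n.*2)%N by rewrite -addnn leq_addr.
apply: le_trans (square_sum_le (Fge0 n.*2) n2).
apply: (@le_trans _ _ (square_sum n (F n))).
  rewrite le_eqVlt; apply/orP; left; apply/eqP; apply: eq_square_sum => k k' kn k'n.
  apply: eq_square_sum => l l' ln l'n.
  have lt2 a b : (a < n -> b < n -> a + b < n.*2)%N.
    by move=> an bn; rewrite -addnn -addSn leq_add // ltnW.
  by rewrite !lt2.
apply: le_square_sum => k k'; apply: square_sum_le => // l l'.
by case: ifP => // _; rewrite mulr_ge0.
Qed.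

End real_cauchy_prod.

(** * Fields with a complete real absolute value *)

(** The norm of [R[i]] takes its values in [R[i]], which is only partially ordered.
    The estimates are made in [R], through [absv]. *)
Record abs_field (R : realType) (K : numFieldType) := AbsField {
  absv :> K -> R;
  real_emb : {rmorphism R -> K};
  absvE : forall x, `|x| = real_emb (absv x);
  real_emb_le : {mono real_emb : a b / a <= b};
  absv_complete : forall u : nat -> K,
    (forall e, 0 < e -> exists n0, forall m n, (n0 <= m)%N -> (n0 <= n)%N ->
       absv (u m - u n) <= e) ->
    exists l, forall e, 0 < e -> exists n0, forall n, (n0 <= n)%N ->
       absv (u n - l) <= e }.

Section absolute_value.
Context (R : realType) (K : numFieldType) (N : abs_field R K).
Implicit Types (x y : K) (u : nat -> K) (f g : nat -> nat -> K).

Lemma real_emb_inj : injective (real_emb N).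
Proof. exact: inc_inj (real_emb_le N). Qed.

Lemma absv_ge0 x : 0 <= N x.
Proof. by rewrite -(real_emb_le N) rmorph0 -(absvE N). Qed.

Lemma absv0 : N 0 = 0.
Proof. by apply: real_emb_inj; rewrite -(absvE N) normr0 rmorph0. Qed.

Lemma absv0_eq x : N x = 0 -> x = 0.
Proof. by move=> x0; apply/eqP; rewrite -normr_eq0 (absvE N) x0 rmorph0. Qed.

Lemma absvM x y : N (x * y) = N x * N y.
Proof. by apply: real_emb_inj; rewrite rmorphM -!(absvE N) normrM. Qed.

Lemma absv1 : N 1 = 1.
Proof. by apply: real_emb_inj; rewrite -(absvE N) normr1 rmorph1. Qed.

Lemma absvX x n : N (x ^+ n) = N x ^+ n.
Proof. by apply: real_emb_inj; rewrite rmorphXn /= -!(absvE N) normrX. Qed.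

Lemma absvN x : N (- x) = N x.
Proof. by apply: real_emb_inj; rewrite -!(absvE N) normrN. Qed.

Lemma absvD x y : N (x + y) <= N x + N y.
Proof. by rewrite -(real_emb_le N) rmorphD /= -!(absvE N) ler_normD. Qed.

Lemma absvB x y : N (x - y) <= N x + N y.
Proof. by rewrite -(absvN y) absvD. Qed.

Lemma absv_distC x y : N (x - y) = N (y - x).
Proof. by rewrite -absvN opprB. Qed.

Lemma absv_sum (I : Type) (r : seq I) (P : pred I) (F : I -> K) :
  N (\sum_(i <- r | P i) F i) <= \sum_(i <- r | P i) N (F i).
Proof.
elim/big_rec2: _ => [|i y x _ le_xy]; first by rewrite absv0.
by rewrite (le_trans (absvD _ _)) // lerD2l.
Qed.

Lemma absv_nat n : N n%:R = n%:R.
Proof. by apply: real_emb_inj; rewrite rmorph_nat -(absvE N) normr_nat. Qed.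

Lemma absvV x : N x^-1 = (N x)^-1.
Proof. by apply: real_emb_inj; rewrite fmorphV -!(absvE N) normfV. Qed.

Lemma absv_emb r : 0 <= r -> N (real_emb N r) = r.
Proof.
move=> r0; apply: real_emb_inj.
by rewrite -(absvE N) ger0_norm // -(rmorph0 (real_emb N)) real_emb_le.
Qed.

Lemma absv_square_sum n f :
  N (square_sum n f) <= square_sum n (fun i j => N (f i j)).
Proof.
by apply: le_trans (absv_sum _ _ _) _; apply: ler_sum => i _; exact: absv_sum.
Qed.

(** ** Limits of sequences and sums of double series *)

Definition tends u l := forall e, 0 < e ->
  exists n0, forall n, (n0 <= n)%N -> N (u n - l) <= e.

Lemma absv_small x : (forall e, 0 < e -> N x <= e) -> x = 0.
Proof.
move=> x_small; apply: absv0_eq; apply/eqP; rewrite eq_le absv_ge0 andbT.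
by apply/ler_addgt0Pr => e e0; rewrite add0r x_small.
Qed.

Lemma tends_unique u l l' : tends u l -> tends u l' -> l = l'.
Proof.
move=> ul ul'; apply/subr0_eq/absv_small => e e0.
have [|n ln] := ul (e / 2); first by rewrite divr_gt0.
have [|n' ln'] := ul' (e / 2); first by rewrite divr_gt0.
have -> : l - l' = (u (maxn n n') - l') - (u (maxn n n') - l) by ring.
rewrite (splitr e) (le_trans (absvB _ _)) // lerD ?ln ?ln' ?leq_maxl //.
by rewrite leq_maxr.
Qed.

Lemma tends_near u v l n0 : (forall n, (n0 <= n)%N -> u n = v n) ->
  tends u l -> tends v l.
Proof.
move=> uv ul e e0; have [n1 ln] := ul e e0.
by exists (maxn n0 n1) => n; rewrite geq_max => /andP[nn0 nn1]; rewrite -uv ?ln.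
Qed.

Lemma tends_cst l : tends (fun=> l) l.
Proof. by move=> e /ltW e0; exists 0%N => n _; rewrite subrr absv0. Qed.

Lemma tendsD u v l l' : tends u l -> tends v l' ->
  tends (fun n => u n + v n) (l + l').
Proof.
move=> ul vl' e e0.
have [|n ln] := ul (e / 2); first by rewrite divr_gt0.
have [|n' ln'] := vl' (e / 2); first by rewrite divr_gt0.
exists (maxn n n') => m; rewrite geq_max => /andP[nm n'm].
have -> : u m + v m - (l + l') = (u m - l) + (v m - l') by ring.
by rewrite (splitr e) (le_trans (absvD _ _)) // lerD ?ln ?ln'.
Qed.

Lemma tendsMl c u l : tends u l -> tends (fun n => c * u n) (c * l).
Proof.
move=> ul e e0; have c0 : 0 < N c + 1 by rewrite ltr_wpDl ?absv_ge0.
have [|n ln] := ul (e / (N c + 1)); first by rewrite divr_gt0.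
exists n => m nm; rewrite -mulrBr absvM.
apply: (@le_trans _ _ ((N c + 1) * (e / (N c + 1)))).
  by rewrite ler_pM ?absv_ge0 ?ln // lerDl.
by rewrite mulrCA divff ?mulr1 // gt_eqF.
Qed.

Lemma tendsN u l : tends u l -> tends (fun n => - u n) (- l).
Proof.
move=> /(tendsMl (-1)); rewrite mulN1r; apply: (tends_near (n0 := 0%N)) => n _.
by rewrite mulN1r.
Qed.

Lemma tends_le u l M : tends u l -> (forall n, N (u n) <= M) -> N l <= M.
Proof.
move=> ul uM; apply/ler_addgt0Pr => e e0; have [n ln] := ul e e0.
have -> : l = u n - (u n - l) by ring.
by rewrite (le_trans (absvB _ _)) // lerD ?ln.
Qed.

Definition double_sum f s := tends (fun n => square_sum n f) s.

Definition abs_bounded f M :=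
  forall n, square_sum n (fun i j => N (f i j)) <= M.

Lemma abs_bounded_ge0 f M : abs_bounded f M -> 0 <= M.
Proof. by move=> /(_ 0%N); rewrite /square_sum big_ord0. Qed.

Lemma double_sumD f g s t : double_sum f s -> double_sum g t ->
  double_sum (fun i j => f i j + g i j) (s + t).
Proof.
move=> fs gt; apply: (tends_near (n0 := 0%N)) (tendsD fs gt) => n _.
by rewrite square_sumD.
Qed.

Lemma double_sumMl c f s : double_sum f s ->
  double_sum (fun i j => c * f i j) (c * s).
Proof.
move=> fs; apply: (tends_near (n0 := 0%N)) (tendsMl c fs) => n _.
by rewrite square_sumMl.
Qed.

Lemma double_sumN f s : double_sum f s -> double_sum (fun i j => - f i j) (- s).
Proof.
move=> fs; apply: (tends_near (n0 := 0%N)) (tendsN fs) => n _.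
by rewrite square_sumN.
Qed.

Lemma double_sum_le f s M : double_sum f s -> abs_bounded f M -> N s <= M.
Proof.
move=> fs fM; apply: tends_le fs _ => n.
by rewrite (le_trans (absv_square_sum _ _)).
Qed.

(** The sums of the absolute values over squares form a bounded increasing sequence:
    what remains outside a large square is at most the distance to its limit. *)
Lemma abs_bounded_tail f M e : abs_bounded f M -> 0 < e ->
  exists n0, forall n1 (P : nat -> nat -> bool),
    (forall i j, (i < n0)%N -> (j < n0)%N -> ~~ P i j) ->
    square_sum n1 (fun i j => if P i j then N (f i j) else 0) <= e.
Proof.
move=> fM e0; pose F n := square_sum n (fun i j => N (f i j)).
have F_mono m n : (m <= n)%N -> F m <= F n.
  by apply: square_sum_le => i j; exact: absv_ge0.
have [l Fl l_lim] := bounded_increasing_cvg F_mono fM.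
have [n0 ln0] := l_lim _ e0; exists n0 => n1 P Pn0.
pose n := maxn n0 n1.
apply: (@le_trans _ _ (square_sum n (fun i j => if P i j then N (f i j) else 0))).
  by apply: square_sum_le => [i j|]; rewrite ?leq_maxr //; case: ifP; rewrite ?absv_ge0.
rewrite -(lerD2r (F n0)).
apply: (@le_trans _ _ (F n)); last first.
  by rewrite (le_trans (Fl _)) // addrC -lerBlDr ln0.
rewrite /F.
apply: (@le_trans _ _ (square_sum n (fun i j =>
  (if P i j then N (f i j) else 0) + if ~~ P i j then N (f i j) else 0))); last first.
  by apply: le_square_sum => i j; case: (P i j); rewrite /= ?addr0 ?add0r.
rewrite square_sumD lerD2l.
rewrite (@eq_square_sum _ n0 _ (fun i j => if ~~ P i j then N (f i j) else 0)).
  by apply: square_sum_le => [i j|]; rewrite ?leq_maxl //; case: ifP; rewrite ?absv_ge0.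
by move=> i j i0 j0; rewrite Pn0.
Qed.

Lemma abs_bounded_square_diff f M e : abs_bounded f M -> 0 < e ->
  exists n0, forall m n, (n0 <= m)%N -> (m <= n)%N ->
    N (square_sum n f - square_sum m f) <= e.
Proof.
move=> fM e0; have [n0 tail] := abs_bounded_tail fM e0.
exists n0 => m n n0m mn.
pose P i j := ~~ ((i < m)%N && (j < m)%N).
have -> : square_sum n f - square_sum m f =
    square_sum n (fun i j => if P i j then f i j else 0).
  have cut : square_sum m f = square_sum n (fun i j => if ~~ P i j then f i j else 0).
    rewrite /square_sum (big_ord_widen n (fun i => \sum_(j < m) f i j)) //.
    rewrite big_mkcond; apply: eq_bigr => i _ /=.
    case: ifP => im; last by rewrite big1 // => j _; rewrite /P im.
    rewrite (big_ord_widen n (f i)) // big_mkcond; apply: eq_bigr => j _ /=.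
    by rewrite /P im negbK.
  rewrite cut -square_sumN -square_sumD; apply: eq_square_sum => i j _ _.
  by case: (P i j); rewrite /= ?subr0 ?subrr.
apply: le_trans (absv_square_sum _ _) _.
apply: le_trans (tail n P _); last first.
  by move=> i j i0 j0; rewrite /P !(leq_trans _ n0m).
by apply: le_square_sum => i j; case: ifP; rewrite ?absv0.
Qed.

Lemma double_sum_exists f M : abs_bounded f M -> exists s, double_sum f s.
Proof.
move=> fM; apply: (@absv_complete _ _ N) => e e0.
have [n0 fn0] := abs_bounded_square_diff fM e0.
exists n0 => m n mn0 nn0; case: (leqP m n) => mn; last by rewrite fn0 // ltnW.
by rewrite absv_distC fn0.
Qed.

Lemma square_sum_mul_cauchy_prod_dist f g n :
  N (square_sum n f * square_sum n g - square_sum n (cauchy_prod f g)) <=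
  square_sum n (fun i j => N (f i j)) * square_sum n (fun i j => N (g i j)) -
  square_sum n (cauchy_prod (fun i j => N (f i j)) (fun i j => N (g i j))).
Proof.
rewrite !square_sum_mul !square_sum_cauchy_prod -!square_sumN -!square_sumD.
apply: le_trans (absv_square_sum _ _) _; apply: le_square_sum => k k'.
rewrite -!square_sumN -!square_sumD.
apply: le_trans (absv_square_sum _ _) _; apply: le_square_sum => l l'.
by case: ifP => _; rewrite ?subrr ?absv0 // !subr0 absvM.
Qed.

(** Mertens: the defect between the product of the partial sums and the partial
    sum of the product is controlled by the same defect for the absolute values,
    which is at most the difference of two late values of a bounded increasing
    sequence. *)
Lemma double_sum_cauchy_prod f g s t A B : abs_bounded f A -> abs_bounded g B ->
  double_sum f s -> double_sum g t -> double_sum (cauchy_prod f g) (s * t).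
Proof.
move=> fA gB fs gt e e0.
pose F n := square_sum n (fun i j => N (f i j)).
pose G n := square_sum n (fun i j => N (g i j)).
have F0 n : 0 <= F n by apply: square_sum_ge0 => i j; exact: absv_ge0.
have G0 n : 0 <= G n by apply: square_sum_ge0 => i j; exact: absv_ge0.
have FG_mono m n : (m <= n)%N -> F m * G m <= F n * G n.
  by move=> mn; rewrite ler_pM // square_sum_le // => i j; exact: absv_ge0.
have FG_bd n : F n * G n <= A * B by rewrite ler_pM //; [exact: fA | exact: gB].
have [l FGl l_lim] := bounded_increasing_cvg FG_mono FG_bd.
have e4 : 0 < e / 4 by rewrite divr_gt0.
have AB1 : 0 < A + B + 1.
  by rewrite ltr_wpDl // addr_ge0 // ?(abs_bounded_ge0 fA) ?(abs_bounded_ge0 gB).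
have [n0 ln0] := l_lim _ e4.
have [|n1 sn1] := fs (e / 4 / (A + B + 1)); first by rewrite divr_gt0.
have [|n2 tn2] := gt (e / 4 / (A + B + 1)); first by rewrite divr_gt0.
exists (maxn n0.*2 (maxn n1 n2)) => n; rewrite !geq_max => /and3P[n0n n1n n2n].
set Fn := square_sum n f; set Gn := square_sum n g.
have -> : square_sum n (cauchy_prod f g) - s * t =
  (Fn - s) * Gn + s * (Gn - t) - (Fn * Gn - square_sum n (cauchy_prod f g)) by ring.
have FnA : N Fn <= A by rewrite (le_trans (absv_square_sum _ _)).
have GnB : N Gn <= B by rewrite (le_trans (absv_square_sum _ _)).
have sA := double_sum_le fs fA.
have q0 : 0 <= e / 4 / (A + B + 1) by rewrite divr_ge0 ?ltW.
have bd1 : N ((Fn - s) * Gn) <= e / 4.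
  rewrite absvM; apply: (@le_trans _ _ (e / 4 / (A + B + 1) * (A + B + 1))).
    rewrite ler_pM ?absv_ge0 ?sn1 // (le_trans GnB) // -addrA addrCA lerDl.
    by rewrite addr_ge0 // (abs_bounded_ge0 fA).
  by rewrite divfK // gt_eqF.
have bd2 : N (s * (Gn - t)) <= e / 4.
  rewrite absvM mulrC; apply: (@le_trans _ _ (e / 4 / (A + B + 1) * (A + B + 1))).
    rewrite ler_pM ?absv_ge0 ?tn2 // (le_trans sA) // -addrA lerDl.
    by rewrite addr_ge0 // (abs_bounded_ge0 gB).
  by rewrite divfK // gt_eqF.
have bd3 : N (Fn * Gn - square_sum n (cauchy_prod f g)) <= e / 4.
  apply: le_trans (square_sum_mul_cauchy_prod_dist f g n) _.
  rewrite -/(F n) -/(G n) lerBlDr; apply: le_trans (FGl n) _.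
  rewrite addrC -lerBlDr; apply: le_trans (ln0 n0 (leqnn _)) _.
  apply: le_trans (square_sum_cauchy_prod_ge _ _ n0) _ => [i j|i j|]; rewrite ?absv_ge0 //.
  by apply: square_sum_le => // i j; apply: cauchy_prod_ge0 => k l'; exact: absv_ge0.
rewrite (le_trans (absvB _ _)) //.
have := le_trans (absvD _ _) (lerD bd1 bd2).
by move: bd3 e0; lra.
Qed.

End absolute_value.

(** * Formal double series and their weighted norms *)

Lemma square_sum_restrict (V : nmodType) m n (f : nat -> nat -> V) : (m <= n)%N ->
  square_sum m f = square_sum n (fun i j => if (i < m)%N && (j < m)%N then f i j else 0).
Proof.
move=> mn; rewrite /square_sum (big_ord_widen n (fun i => \sum_(j < m) f i j)) //.
rewrite big_mkcond; apply: eq_bigr => i _ /=.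
case: ifP => im /=; last by rewrite big1.
by rewrite (big_ord_widen n (f i)) // big_mkcond.
Qed.

Section formal_series.
Context (R : realType) (K : numFieldType) (N : abs_field R K).
Notation dseries := (nat -> nat -> K).
Implicit Types (a b h : dseries) (w : nat -> nat -> R).

Definition one_series : dseries := fun i j => ((i == 0%N) && (j == 0%N))%:R.
Definition fst_series : dseries := fun i j => ((i == 1%N) && (j == 0%N))%:R.
Definition snd_series : dseries := fun i j => ((i == 0%N) && (j == 1%N))%:R.
Definition pow_series a n : dseries := iter n (cauchy_prod a) one_series.
Definition monomial_series a b k l : dseries :=
  cauchy_prod (pow_series a k) (pow_series b l).

(** The truncation of the substitution at total degree [i + j] loses nothing when
    the substituted series have no constant term. *)
Definition comp_series h a b : dseries := fun i j =>
  square_sum (i + j).+1 (fun k l => h k l * monomial_series a b k l i j).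

Definition vanishes_below d a := forall i j, (i + j < d)%N -> a i j = 0.

Lemma vanishes_below0 a : vanishes_below 0 a.
Proof. by move=> i j; rewrite ltn0. Qed.

Lemma vanishes_below_cauchy_prod d e a b : vanishes_below d a ->
  vanishes_below e b -> vanishes_below (d + e) (cauchy_prod a b).
Proof.
move=> ad be i j ijde; rewrite /cauchy_prod big1 // => k _; rewrite big1 // => l _.
case: (ltnP (k + l) d) => [kld|dkl]; first by rewrite ad // mul0r.
rewrite be ?mulr0 //; have := ltn_ord k; have := ltn_ord l.
by rewrite !ltnS => lj ki; lia.
Qed.

Lemma vanishes_below_pow a n : a 0%N 0%N = 0 -> vanishes_below n (pow_series a n).
Proof.
move=> a0; elim: n => [|n IHn]; first exact: vanishes_below0.
apply: (@vanishes_below_cauchy_prod 1) IHn => i j; rewrite ltnS leqn0 addn_eq0.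
by move=> /andP[/eqP-> /eqP->].
Qed.

Lemma vanishes_below_monomial a b k l : a 0%N 0%N = 0 -> b 0%N 0%N = 0 ->
  vanishes_below (k + l) (monomial_series a b k l).
Proof.
by move=> a0 b0; apply: vanishes_below_cauchy_prod; exact: vanishes_below_pow.
Qed.

Lemma comp_series_widen h a b i j m : a 0%N 0%N = 0 -> b 0%N 0%N = 0 ->
  (i + j < m)%N ->
  comp_series h a b i j = square_sum m (fun k l => h k l * monomial_series a b k l i j).
Proof.
move=> a0 b0 ijm; rewrite /comp_series (square_sum_restrict _ ijm).
apply: eq_square_sum => k l _ _; case: ifPn => // kl.
rewrite vanishes_below_monomial ?mulr0 //.
by move: kl; rewrite negb_and -!leqNgt => /orP[]; lia.
Qed.

(** ** Weighted norms *)

Definition wnorm_le w a M :=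
  forall n, square_sum n (fun i j => N (a i j) * w i j) <= M.

Definition submultiplicative w :=
  [/\ forall i j, 0 <= w i j, w 0%N 0%N <= 1 &
      forall i j k l, w (i + k)%N (j + l)%N <= w i j * w k l].

Definition polydisc_weight (r s : R) i j := r ^+ i * s ^+ j.

Lemma polydisc_submultiplicative r s : 0 <= r -> 0 <= s ->
  submultiplicative (polydisc_weight r s).
Proof.
move=> r0 s0; split=> [i j||i j k l].
- by rewrite mulr_ge0 ?exprn_ge0.
- by rewrite /polydisc_weight !expr0 mulr1.
- by rewrite /polydisc_weight !exprD mulrACA.
Qed.

Lemma wnorm_ge0 w a M : wnorm_le w a M -> 0 <= M.
Proof. by move=> /(_ 0%N); rewrite /square_sum big_ord0. Qed.

Lemma wnorm_leW w a M M' : M <= M' -> wnorm_le w a M -> wnorm_le w a M'.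
Proof. by move=> MM' aM n; rewrite (le_trans (aM n)). Qed.

Lemma wnorm_weight w w' a M : (forall i j, w' i j <= w i j) ->
  wnorm_le w a M -> wnorm_le w' a M.
Proof.
move=> w'w aM n; apply: le_trans (aM n); apply: le_square_sum => i j.
by rewrite ler_wpM2l ?absv_ge0.
Qed.

Lemma wnormD w a b A B : (forall i j, 0 <= w i j) -> wnorm_le w a A -> wnorm_le w b B ->
  wnorm_le w (fun i j => a i j + b i j) (A + B).
Proof.
move=> w0 aA bB n; apply: le_trans (lerD (aA n) (bB n)).
rewrite -square_sumD; apply: le_square_sum => i j.
by rewrite -mulrDl ler_wpM2r // absvD.
Qed.

Lemma wnormN w a A : wnorm_le w a A -> wnorm_le w (fun i j => - a i j) A.
Proof.
move=> aA n; apply: le_trans (aA n); apply: le_square_sum => i j.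
by rewrite absvN.
Qed.

Lemma wnormZ w a A c : wnorm_le w a A -> wnorm_le w (fun i j => c * a i j) (N c * A).
Proof.
move=> aA n; apply: le_trans (ler_wpM2l (absv_ge0 N c) (aA n)).
rewrite -square_sumMl; apply: le_square_sum => i j.
by rewrite absvM mulrA.
Qed.

Lemma wnorm_cauchy_prod w a b A B : submultiplicative w ->
  wnorm_le w a A -> wnorm_le w b B -> wnorm_le w (cauchy_prod a b) (A * B).
Proof.
move=> [w0 _ wM] aA bB n.
pose f i j := N (a i j) * w i j; pose g i j := N (b i j) * w i j.
have f0 i j : 0 <= f i j by rewrite mulr_ge0 ?absv_ge0.
have g0 i j : 0 <= g i j by rewrite mulr_ge0 ?absv_ge0.
apply: (@le_trans _ _ (square_sum n (cauchy_prod f g))).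
  apply: le_square_sum => i j.
  apply: le_trans (ler_wpM2r (w0 _ _) (absv_sum _ _ _ _)) _.
  rewrite mulr_suml; apply: ler_sum => k _.
  apply: le_trans (ler_wpM2r (w0 _ _) (absv_sum _ _ _ _)) _.
  rewrite mulr_suml; apply: ler_sum => l _; rewrite absvM.
  have ki : (k <= i)%N by rewrite -ltnS.
  have lj : (l <= j)%N by rewrite -ltnS.
  rewrite /f /g mulrACA ler_wpM2l ?mulr_ge0 ?absv_ge0 //.
  by rewrite -{1}(subnKC ki) -{1}(subnKC lj).
apply: le_trans (square_sum_cauchy_prod_le f0 g0 n) _.
exact: (ler_pM (square_sum_ge0 n f0) (square_sum_ge0 n g0) (aA n) (bB n)).
Qed.

Lemma square_sum_unit (A : pzRingType) n k l (c : A) :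
  square_sum n (fun i j => if (i == k) && (j == l) then c else 0) =
  if (k < n)%N && (l < n)%N then c else 0.
Proof.
have [kn|nk] := ltnP k n; last first.
  rewrite /square_sum big1 // => i _; rewrite big1 // => j _.
  by case: eqP => // ik; have := ltn_ord i; rewrite ik ltnNge nk.
rewrite /square_sum (bigD1 (Ordinal kn)) //= [X in _ + X]big1; last first.
  move=> i; rewrite -val_eqE /= => /negPf->; rewrite big1 //.
rewrite addr0 eqxx /=; have [ln|nl] := ltnP l n; last first.
  rewrite big1 // => j _.
  by case: eqP => // jl; have := ltn_ord j; rewrite jl ltnNge nl.
rewrite (bigD1 (Ordinal ln)) //= eqxx big1 ?addr0 // => j.
by rewrite -val_eqE /= => /negPf->.
Qed.

Lemma wnorm_unit w k l : 0 <= w k l ->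
  wnorm_le w (fun i j => ((i == k) && (j == l))%:R) (w k l).
Proof.
move=> w0 n.
rewrite (@eq_square_sum _ _ _ (fun i j => if (i == k) && (j == l) then w k l else 0)).
  by rewrite square_sum_unit; case: ifP.
move=> i j _ _; case: ifP => [/andP[/eqP-> /eqP->]|]; rewrite ?absv1 ?mul1r //.
by rewrite absv0 mul0r.
Qed.

Lemma wnorm_one w : submultiplicative w -> wnorm_le w one_series 1.
Proof. by move=> [w0 w1 _]; apply: wnorm_leW w1 _; exact: wnorm_unit. Qed.

Lemma wnorm_pow w a A n : submultiplicative w -> wnorm_le w a A ->
  wnorm_le w (pow_series a n) (A ^+ n).
Proof.
move=> wM aA; elim: n => [|n IHn]; first by rewrite expr0; exact: wnorm_one.
by rewrite exprS; exact: wnorm_cauchy_prod.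
Qed.

Lemma wnorm_monomial w a b A B k l : submultiplicative w ->
  wnorm_le w a A -> wnorm_le w b B ->
  wnorm_le w (monomial_series a b k l) (A ^+ k * B ^+ l).
Proof. by move=> wM aA bB; apply: wnorm_cauchy_prod => //; exact: wnorm_pow. Qed.

Lemma wnorm_comp w h a b A B C : submultiplicative w ->
  wnorm_le w a A -> wnorm_le w b B -> wnorm_le (polydisc_weight A B) h C ->
  wnorm_le w (comp_series h a b) C.
Proof.
move=> wM aA bB hC n; have [w0 _ _] := wM.
apply: (@le_trans _ _ (square_sum n (fun i j => square_sum n.*2 (fun k l =>
    N (h k l) * (N (monomial_series a b k l i j) * w i j))))).
  apply: ler_sum => i _; apply: ler_sum => j _.
  apply: le_trans (ler_wpM2r (w0 _ _) (absv_square_sum _ _ _)) _.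
  rewrite -square_sumMr.
  have ijn : ((i + j).+1 <= n.*2)%N.
    by rewrite -addnn -addSn leq_add // ltnW.
  apply: le_trans (square_sum_le _ ijn) => [|k l]; last first.
    by rewrite !mulr_ge0 ?absv_ge0.
  by apply: le_square_sum => k l; rewrite absvM mulrA.
rewrite square_sum_exchange; apply: le_trans (hC n.*2).
apply: le_square_sum => k l; rewrite square_sumMl ler_wpM2l ?absv_ge0 //.
exact: wnorm_monomial.
Qed.

(** ** Values of a series at a point *)

Definition has_val a x y s := double_sum N (fun i j => a i j * (x ^+ i * y ^+ j)) s.

Lemma wnorm_abs_bounded r s a M x y : N x <= r -> N y <= s ->
  wnorm_le (polydisc_weight r s) a M ->
  abs_bounded N (fun i j => a i j * (x ^+ i * y ^+ j)) M.
Proof.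
move=> xr ys aM n; apply: le_trans (aM n); apply: le_square_sum => i j.
rewrite !absvM !absvX ler_wpM2l ?absv_ge0 //.
have lerXn z t k : N z <= t -> N z ^+ k <= t ^+ k.
  by move=> zt; rewrite lerXn2r ?nnegrE ?absv_ge0 ?(le_trans (absv_ge0 _ _) zt).
by rewrite ler_pM ?exprn_ge0 ?absv_ge0 ?lerXn.
Qed.

Lemma has_val_exists r s a M x y : N x <= r -> N y <= s ->
  wnorm_le (polydisc_weight r s) a M -> exists t, has_val a x y t.
Proof. by move=> xr ys aM; exact: double_sum_exists (wnorm_abs_bounded xr ys aM). Qed.

Lemma has_val_le r s a M x y t : N x <= r -> N y <= s ->
  wnorm_le (polydisc_weight r s) a M -> has_val a x y t -> N t <= M.
Proof. by move=> xr ys aM at_; exact: double_sum_le at_ (wnorm_abs_bounded xr ys aM). Qed.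

Lemma has_val_unique a x y s t : has_val a x y s -> has_val a x y t -> s = t.
Proof. exact: tends_unique. Qed.

Lemma has_valD a b x y s t : has_val a x y s -> has_val b x y t ->
  has_val (fun i j => a i j + b i j) x y (s + t).
Proof.
move=> as_ bt; apply: (tends_near (n0 := 0%N)) (double_sumD as_ bt) => n _.
by apply: eq_square_sum => i j _ _; rewrite mulrDl.
Qed.

Lemma has_valZ a x y s c : has_val a x y s ->
  has_val (fun i j => c * a i j) x y (c * s).
Proof.
move=> as_; apply: (tends_near (n0 := 0%N)) (double_sumMl c as_) => n _.
by apply: eq_square_sum => i j _ _; rewrite mulrA.
Qed.

Lemma has_valN a x y s : has_val a x y s -> has_val (fun i j => - a i j) x y (- s).
Proof.
move=> as_; apply: (tends_near (n0 := 0%N)) (double_sumN as_) => n _.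
by apply: eq_square_sum => i j _ _; rewrite mulNr.
Qed.

Lemma has_val_unit k l x y :
  has_val (fun i j => ((i == k) && (j == l))%:R) x y (x ^+ k * y ^+ l).
Proof.
apply: (tends_near (n0 := (maxn k l).+1)) (tends_cst N _) => n.
rewrite gtn_max => /andP[kn ln].
rewrite (@eq_square_sum _ _ _ (fun i j =>
  if (i == k) && (j == l) then x ^+ k * y ^+ l else 0)).
  by rewrite square_sum_unit kn ln.
by move=> i j _ _; case: ifP => [/andP[/eqP-> /eqP->]|]; rewrite ?mul1r ?mul0r.
Qed.

Lemma has_val_cauchy_prod r s a b A B x y t t' : N x <= r -> N y <= s ->
  wnorm_le (polydisc_weight r s) a A -> wnorm_le (polydisc_weight r s) b B ->
  has_val a x y t -> has_val b x y t' -> has_val (cauchy_prod a b) x y (t * t').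
Proof.
move=> xr ys aA bB at_ bt'.
apply: (tends_near (n0 := 0%N)) (double_sum_cauchy_prod
  (wnorm_abs_bounded xr ys aA) (wnorm_abs_bounded xr ys bB) at_ bt') => n _.
apply: eq_square_sum => i j _ _; rewrite /cauchy_prod mulr_suml.
apply: eq_bigr => k _; rewrite mulr_suml; apply: eq_bigr => l _.
have ki : (k <= i)%N by rewrite -ltnS.
have lj : (l <= j)%N by rewrite -ltnS.
have -> : x ^+ i = x ^+ k * x ^+ (i - k) by rewrite -exprD subnKC.
have -> : y ^+ j = y ^+ l * y ^+ (j - l) by rewrite -exprD subnKC.
ring.
Qed.

Lemma has_val_monomial r s a b A B x y t t' k l : 0 <= r -> 0 <= s ->
  N x <= r -> N y <= s ->
  wnorm_le (polydisc_weight r s) a A -> wnorm_le (polydisc_weight r s) b B ->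
  has_val a x y t -> has_val b x y t' ->
  has_val (monomial_series a b k l) x y (t ^+ k * t' ^+ l).
Proof.
move=> r0 s0 xr ys aA bB at_ bt'.
have wM := polydisc_submultiplicative r0 s0.
have hpow c C t0 n : wnorm_le (polydisc_weight r s) c C -> has_val c x y t0 ->
    has_val (pow_series c n) x y (t0 ^+ n).
  move=> cC ct0; elim: n => [|n IHn].
    by have := has_val_unit 0 0 x y; rewrite !expr0 mulr1.
  by rewrite exprS; apply: has_val_cauchy_prod xr ys cC (wnorm_pow n wM cC) _ _.
by apply: has_val_cauchy_prod xr ys (wnorm_pow k wM aA) (wnorm_pow l wM bB) _ _;
  apply: hpow; eassumption.
Qed.

Lemma has_val_square_sum m (F : nat -> nat -> dseries) (G : nat -> nat -> K) x y :
  (forall k l, has_val (F k l) x y (G k l)) ->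
  has_val (fun i j => square_sum m (fun k l => F k l i j)) x y (square_sum m G).
Proof.
move=> FG.
have sum0 : has_val (fun _ _ => 0) x y 0.
  apply: (tends_near (n0 := 0%N)) (tends_cst N 0) => n _.
  by rewrite -[LHS](square_sum0 K n); apply: eq_square_sum => i j _ _; rewrite mul0r.
have sum1 n (f : nat -> dseries) (g : nat -> K) : (forall k, has_val (f k) x y (g k)) ->
    has_val (fun i j => \sum_(k < n) f k i j) x y (\sum_(k < n) g k).
  move=> fg; elim: n => [|n IHn].
    rewrite big_ord0; apply: (tends_near (n0 := 0%N)) sum0 => n _.
    by apply: eq_square_sum => i j _ _; rewrite big_ord0.
  rewrite big_ord_recr /=; apply: (tends_near (n0 := 0%N)) (has_valD IHn (fg n)) => m' _.
  by apply: eq_square_sum => i j _ _; rewrite big_ord_recr.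
apply: (sum1 m (fun k i j => \sum_(l < m) F k l i j) (fun k => \sum_(l < m) G k l)) => k.
exact: (sum1 m (F k) (G k)).
Qed.

(** Replacing the outer series by a polynomial commits an error controlled by
    the tail of that series, both for the formal substitution and for the values. *)
Lemma has_val_comp r s h a b A B C x y t t' z : 0 <= r -> 0 <= s ->
  N x <= r -> N y <= s -> a 0%N 0%N = 0 -> b 0%N 0%N = 0 ->
  wnorm_le (polydisc_weight r s) a A -> wnorm_le (polydisc_weight r s) b B ->
  wnorm_le (polydisc_weight A B) h C ->
  has_val a x y t -> has_val b x y t' -> has_val h t t' z ->
  has_val (comp_series h a b) x y z.
Proof.
move=> r0 s0 xr ys a0 b0 aA bB hC at_ bt' hz.
have wM := polydisc_submultiplicative r0 s0.
have [z' z'P] := has_val_exists xr ys (wnorm_comp wM aA bB hC).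
suff -> : z = z' by [].
apply/subr0_eq/(absv_small (N := N)) => e e0.
have e2 : 0 < e / 2 by rewrite divr_gt0.
have h_abs : abs_bounded N (fun k l => h k l * real_emb N (A ^+ k * B ^+ l)) C.
  move=> n; apply: le_trans (hC n); apply: le_square_sum => k l.
  rewrite absvM absv_emb //.
  by rewrite mulr_ge0 ?exprn_ge0 ?(wnorm_ge0 aA) ?(wnorm_ge0 bB).
have [n1 tail] := abs_bounded_tail h_abs e2.
have [n2 zn2] := hz _ e2.
pose n0 := maxn n1 n2.
pose D : dseries := fun i j =>
  square_sum n0 (fun k l => h k l * monomial_series a b k l i j).
pose z0 := square_sum n0 (fun k l => h k l * (t ^+ k * t' ^+ l)).
have Dz0 : has_val D x y z0.
  apply: (has_val_square_sum n0 (F := fun k l i j => h k l * monomial_series a b k l i j)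
    (G := fun k l => h k l * (t ^+ k * t' ^+ l))) => k l.
  apply: has_valZ; exact: has_val_monomial r0 s0 xr ys aA bB at_ bt'.
pose h' : dseries := fun k l => if ~~ ((k < n0)%N && (l < n0)%N) then h k l else 0.
have h'e : wnorm_le (polydisc_weight A B) h' (e / 2).
  move=> n; apply: le_trans (tail n (fun k l => ~~ ((k < n0)%N && (l < n0)%N)) _).
    apply: le_square_sum => k l; rewrite /h'; case: ifP => _; last by rewrite absv0 mul0r.
    rewrite absvM absv_emb //.
    by rewrite mulr_ge0 ?exprn_ge0 ?(wnorm_ge0 aA) ?(wnorm_ge0 bB).
  by move=> i j i1 j1; rewrite negbK !(leq_trans _ (leq_maxl n1 n2)).
have h'val : has_val (comp_series h' a b) x y (z' + - z0).
  apply: (tends_near (n0 := 0%N)) (has_valD z'P (has_valN Dz0)) => n _.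
  apply: eq_square_sum => i j _ _; congr (_ * _).
  pose m := maxn (i + j).+1 n0.
  rewrite !(@comp_series_widen _ _ _ _ _ m) // ?leq_maxl //.
  rewrite /D (square_sum_restrict _ (leq_maxr (i + j).+1 n0)) -square_sumN -square_sumD.
  apply: eq_square_sum => k l _ _; rewrite /h'.
  by case: ifP => _; rewrite /= ?mul0r ?subrr ?subr0.
have le1 := has_val_le xr ys (wnorm_comp wM aA bB h'e) h'val.
have := zn2 n0 (leq_maxr _ _); rewrite -/z0 => le2.
have -> : z - z' = - (z0 - z) - (z' + - z0) by ring.
by rewrite (splitr e) (le_trans (absvB _ _ _)) // absvN lerD.
Qed.

End formal_series.

(** * Causal fixed points *)

Section causal.
Context (R : realType) (K : numFieldType) (N : abs_field R K).
Notation dseries := (nat -> nat -> K).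
Variable rank : nat -> nat -> nat.
Hypothesis rank_mono : forall i j k l, (i <= k)%N -> (j <= l)%N ->
  (rank i j <= rank k l)%N.
Implicit Types (a b h : dseries) (z : bool -> dseries).

Definition agree n a b := forall i j, (rank i j < n)%N -> a i j = b i j.

(** The [n]-th iterate is final on the indices of rank smaller than [n], so the
    diagonal of the iterates is a fixed point. The predicate [good] has to be
    determined by finitely many coefficients at a time to pass to this limit. *)
Lemma causal_fixpoint (F : (bool -> dseries) -> bool -> dseries)
    (good : (bool -> dseries) -> Prop) z0 :
  good z0 -> (forall z, good z -> good (F z)) ->
  (forall z, (forall n, exists2 z', good z' & forall c, agree n (z c) (z' c)) ->
     good z) ->
  (forall n z z', good z -> good z' -> (forall c, agree n (z c) (z' c)) ->
     forall c, agree n.+1 (F z c) (F z' c)) ->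
  exists2 z, good z & forall c i j, F z c i j = z c i j.
Proof.
move=> good0 goodF good_closed causal.
pose it n := iter n F z0.
have good_it n : good (it n) by elim: n => //= n; exact: goodF.
have agree_it n m : (n <= m)%N -> forall c, agree n (it n c) (it m c).
  elim: n m => [|n IHn] [|m] //=; rewrite ltnS => nm c.
  by apply: causal => // c'; exact: IHn.
pose z c i j := it (rank i j).+1 c i j.
have z_it n c : agree n (z c) (it n c).
  by move=> i j ijn; rewrite /z (agree_it _ _ ijn).
have good_z : good z by apply: good_closed => n; exists (it n).
exists z => // c i j.
by rewrite (causal _ _ _ good_z (good_it (rank i j)) (z_it (rank i j))).
Qed.

Lemma agree_cauchy_prod n a a' b b' : agree n a a' -> agree n b b' ->
  agree n (cauchy_prod a b) (cauchy_prod a' b').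
Proof.
move=> aa bb i j ijn; apply: eq_bigr => k _; apply: eq_bigr => l _.
have ki : (k <= i)%N by rewrite -ltnS.
have lj : (l <= j)%N by rewrite -ltnS.
by rewrite aa ?bb // (leq_ltn_trans _ ijn) // rank_mono ?leq_subr.
Qed.

Lemma agree_monomial n a a' b b' k l : agree n a a' -> agree n b b' ->
  agree n (monomial_series a b k l) (monomial_series a' b' k l).
Proof.
move=> aa bb; have agree_pow c c' m : agree n c c' ->
    agree n (pow_series c m) (pow_series c' m).
  by move=> cc; elim: m => //= m IHm; exact: agree_cauchy_prod.
by apply: agree_cauchy_prod; exact: agree_pow.
Qed.

Lemma agree_comp n h a a' b b' : agree n a a' -> agree n b b' ->
  agree n (comp_series h a b) (comp_series h a' b').
Proof.
move=> aa bb i j ijn; apply: eq_square_sum => k l _ _.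
by rewrite (agree_monomial k l aa bb).
Qed.

Lemma wnorm_closed w M a :
  (forall n, exists2 a', wnorm_le N w a' M & agree n a a') -> wnorm_le N w a M.
Proof.
move=> approx n; have [a' a'M aa'] := approx (rank n n).+1.
rewrite (@eq_square_sum _ _ _ (fun i j => N (a' i j) * w i j)) //.
by move=> i j i_n j_n; rewrite aa' // ltnS rank_mono // ltnW.
Qed.

End causal.

(** * The weights *)

Section weights.
Variable R : realType.
Implicit Types rho tau s : R.

(** A weight of the form [sup_rho rho^j (1 - rho)^i] measures an analytic function of
    [v] on all discs of radius [rho], with the blow-up [(1 - rho)^-i] allowed to the
    coefficient of [u^i]. *)
Definition nagumo_set i j : set R :=
  [set rho ^+ j * (1 - rho) ^+ i | rho in [set rho | 2^-1 <= rho <= 1]].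

Definition nagumo i j : R := sup (nagumo_set i j).

Lemma nagumo_ub i j rho : 2^-1 <= rho <= 1 -> rho ^+ j * (1 - rho) ^+ i <= nagumo i j.
Proof.
move=> rho_in; apply: ub_le_sup; last by exists rho.
exists 1 => _ [t /= /andP[t2 t1] <-].
have t0 : 0 <= t by apply: le_trans t2; rewrite invr_ge0.
by rewrite mulr_ile1 ?exprn_ge0 ?exprn_ile1 ?subr_ge0 // gerBl.
Qed.

Lemma nagumo_le i j M :
  (forall rho, 2^-1 <= rho <= 1 -> rho ^+ j * (1 - rho) ^+ i <= M) -> nagumo i j <= M.
Proof.
move=> le_M; apply: ge_sup; last by move=> _ [rho /= rho_in <-]; exact: le_M.
by exists (1 ^+ j * (1 - 1) ^+ i); exists 1 => //=; rewrite lexx andbT; lra.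
Qed.

Lemma nagumo_ge i j : 2^-1 ^+ i * 2^-1 ^+ j <= nagumo i j.
Proof.
have := @nagumo_ub i j 2^-1; rewrite lexx mulrC.
have -> : 1 - 2^-1 = 2^-1 :> R by lra.
by apply; lra.
Qed.

Lemma nagumo_ge0 i j : 0 <= nagumo i j.
Proof. by apply: le_trans (nagumo_ge i j); rewrite mulr_ge0 // exprn_ge0 // invr_ge0. Qed.

Lemma nagumo_le1 i j : nagumo i j <= 1.
Proof.
apply: nagumo_le => t /andP[t2 t1].
have t0 : 0 <= t by apply: le_trans t2; rewrite invr_ge0.
by rewrite mulr_ile1 ?exprn_ge0 ?exprn_ile1 ?subr_ge0 // gerBl.
Qed.

Lemma nagumoM i j k l : nagumo (i + k) (j + l) <= nagumo i j * nagumo k l.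
Proof.
apply: nagumo_le => t t_in; have /andP[t2 t1] := t_in.
have t0 : 0 <= t by apply: le_trans t2; rewrite invr_ge0.
by rewrite !exprD mulrACA ler_pM ?nagumo_ub ?mulr_ge0 ?exprn_ge0 ?subr_ge0.
Qed.

Lemma nagumoSl i j : nagumo i.+1 j <= nagumo i j.
Proof.
apply: nagumo_le => t t_in; have /andP[t2 t1] := t_in.
have t0 : 0 <= t by apply: le_trans t2; rewrite invr_ge0.
apply: le_trans (nagumo_ub i j t_in).
by rewrite exprS mulrCA ler_piMl ?mulr_ge0 ?exprn_ge0 ?subr_ge0 // gerBl.
Qed.

Lemma nagumoSr i j : nagumo i j <= 2 * nagumo i j.+1.
Proof.
apply: nagumo_le => t t_in; have /andP[t2 t1] := t_in.
have t0 : 0 <= t by apply: le_trans t2; rewrite invr_ge0.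
have := nagumo_ub i j.+1 t_in; rewrite exprS.
have : 0 <= t ^+ j * (1 - t) ^+ i by rewrite mulr_ge0 ?exprn_ge0 ?subr_ge0.
move: (t ^+ j) ((1 - t) ^+ i) => p q pq0; rewrite -mulrA; move: (p * q) pq0 => pq; nra.
Qed.

(** Nagumo's estimate: moving the radius from [rho] towards 1 by a fraction
    [1 / (2 (i + 1))] of the remaining distance costs at most a factor 2 on the
    power of the distance and gains [(j + 1) rho^j] times the displacement. *)
Lemma nagumo_derivative i j :
  j.+1%:R * nagumo i.+1 j <= 4 * i.+1%:R * nagumo i j.+1.
Proof.
rewrite -ler_pdivlMl ?ltr0Sn //; apply: nagumo_le => t t_in.
rewrite ler_pdivlMl ?ltr0Sn //; have /andP[t2 t1] := t_in.
have t0 : 0 <= t by apply: le_trans t2; rewrite invr_ge0.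
set n : R := i.+1%:R; have n1 : 1 <= n by rewrite ler1n.
have n0 : 0 < n by rewrite (lt_le_trans ltr01).
pose d : R := (1 - t) / (2 * n); have d0 : 0 <= d.
  by rewrite divr_ge0 ?subr_ge0 // mulr_ge0 // ltW.
have dn : d * (2 * n) = 1 - t by rewrite divfK // gt_eqF // mulr_gt0.
have u_in : 2^-1 <= t + d <= 1 by apply/andP; split; nra.
apply: le_trans (ler_wpM2l _ (nagumo_ub i j.+1 u_in)); last first.
  by rewrite mulr_ge0 // ltW.
have -> : 1 - (t + d) = (1 - t) * (1 - (2 * n)^-1) by rewrite /d; ring.
have bern m : 1 - m%:R * (2 * n)^-1 <= (1 - (2 * n)^-1) ^+ m.
  have q0 : 0 <= (2 * n)^-1 by rewrite invr_ge0 mulr_ge0 // ltW.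
  have q1 : (2 * n)^-1 <= 1 by rewrite invf_le1 ?mulr_gt0 //; nra.
  elim: m => [|m IHm]; first by rewrite mul0r subr0 expr0.
  rewrite exprS -natr1; move: IHm q0 q1.
  have : 0 <= m%:R :> R by [].
  move: ((2 * n)^-1) (m%:R : R) => q m' m0 IHm q0 q1.
  move: ((1 - q) ^+ m) IHm => p IHm.
  have : (1 - q) * (1 - m' * q) <= (1 - q) * p.
    by apply: ler_wpM2l => //; rewrite subr_ge0.
  have : 0 <= m' * q * q by rewrite !mulr_ge0.
  nra.
have half : 2^-1 <= (1 - (2 * n)^-1) ^+ i.
  apply: le_trans (bern i); have : i%:R <= n by rewrite ler_nat.
  have : (2 * n)^-1 * (2 * n) = 1 by rewrite mulVf // gt_eqF // mulr_gt0.
  have : 0 <= (2 * n)^-1 by rewrite invr_ge0 mulr_ge0 // ltW.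
  move: ((2 * n)^-1) (i%:R : R) => q i'; nra.
have grow m : m%:R * t ^+ m.-1 * d <= (t + d) ^+ m - t ^+ m.
  elim: m => [|m IHm]; first by rewrite !mul0r expr0 subrr.
  rewrite -natr1 /=; case: m IHm => [|m] /= IHm.
    by rewrite expr1 !expr0 expr1; lra.
  have -> : (t + d) ^+ m.+2 - t ^+ m.+2 =
     (t + d) * ((t + d) ^+ m.+1 - t ^+ m.+1) + d * t ^+ m.+1 by rewrite !exprS; ring.
  have : (t + d) * (m.+1%:R * t ^+ m * d) <=
     (t + d) * ((t + d) ^+ m.+1 - t ^+ m.+1) by rewrite ler_wpM2l // addr_ge0.
  have : 0 <= d * (m.+1%:R * t ^+ m * d) by rewrite mulr_ge0 // mulr_ge0 // mulr_ge0 ?exprn_ge0.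
  rewrite [t ^+ m.+1]exprS.
  move: ((t + d) ^+ m.+1) (t ^+ m) (m.+1%:R : R) => X T k.
  lra.
have lower : j.+1%:R * t ^+ j * d <= (t + d) ^+ j.+1.
  by apply: le_trans (grow j.+1) _; rewrite gerBl exprn_ge0.
rewrite exprMn.
have -> : j.+1%:R * (t ^+ j * (1 - t) ^+ i.+1) =
    4 * n * ((j.+1%:R * t ^+ j * d) * ((1 - t) ^+ i * 2^-1)).
  by rewrite exprS -dn; field.
rewrite ler_wpM2l ?mulr_ge0 ?(ltW n0) //.
apply: ler_pM lower _.
- by rewrite mulr_ge0 // mulr_ge0 // exprn_ge0.
- by rewrite mulr_ge0 ?invr_ge0 // exprn_ge0 // subr_ge0.
- by rewrite ler_wpM2l // exprn_ge0 // subr_ge0.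
Qed.

Definition ck_weight tau s i j := tau ^+ i * s ^+ j * nagumo i j.

Lemma ck_weight_ge0 tau s i j : 0 <= tau -> 0 <= s -> 0 <= ck_weight tau s i j.
Proof. by move=> tau0 s0; rewrite !mulr_ge0 ?exprn_ge0 ?nagumo_ge0. Qed.

Lemma ck_submultiplicative tau s : 0 <= tau -> 0 <= s ->
  submultiplicative (ck_weight tau s).
Proof.
move=> tau0 s0; split=> [i j||i j k l]; first exact: ck_weight_ge0.
  by rewrite /ck_weight !expr0 !mul1r nagumo_le1.
rewrite /ck_weight !exprD.
have -> : tau ^+ i * tau ^+ k * (s ^+ j * s ^+ l) =
  tau ^+ i * s ^+ j * (tau ^+ k * s ^+ l) by ring.
rewrite [leRHS]mulrACA ler_wpM2l ?nagumoM //.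
by rewrite !mulr_ge0 ?exprn_ge0.
Qed.

Lemma ck_weightSr tau s i j : 0 <= tau -> 0 < s ->
  ck_weight tau s i j <= 2 / s * ck_weight tau s i j.+1.
Proof.
move=> tau0 s0; rewrite /ck_weight exprS.
have -> : 2 / s * (tau ^+ i * (s * s ^+ j) * nagumo i j.+1) =
  tau ^+ i * s ^+ j * (2 * nagumo i j.+1) by field; rewrite gt_eqF.
by rewrite ler_wpM2l ?nagumoSr // mulr_ge0 ?exprn_ge0 // ltW.
Qed.

Lemma ck_weightSl tau s i j : 0 <= tau -> 0 <= s ->
  ck_weight tau s i.+1 j <= tau * ck_weight tau s i j.
Proof.
move=> tau0 s0; rewrite /ck_weight exprS -!mulrA ler_wpM2l //.
by rewrite ler_wpM2l ?exprn_ge0 // ler_wpM2l ?exprn_ge0 // nagumoSl.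
Qed.

Lemma ck_weight_derivative tau s i j : 0 <= tau -> 0 < s ->
  j.+1%:R * ck_weight tau s i.+1 j <= 4 * tau / s * i.+1%:R * ck_weight tau s i j.+1.
Proof.
move=> tau0 s0; rewrite /ck_weight !exprS.
have -> : 4 * tau / s * i.+1%:R * (tau ^+ i * (s * s ^+ j) * nagumo i j.+1) =
  tau * tau ^+ i * s ^+ j * (4 * i.+1%:R * nagumo i j.+1).
  by field; rewrite gt_eqF.
rewrite mulrCA ler_wpM2l ?nagumo_derivative //.
by rewrite !mulr_ge0 ?exprn_ge0 // ltW.
Qed.

(** Finiteness of the weighted norm implies convergence on a genuine polydisc: take
    [rho = 1/2] in the supremum. *)
Lemma ck_weight_ge tau s i j : 0 <= tau -> tau <= s ->
  polydisc_weight (tau / 2) (tau / 2) i j <= ck_weight tau s i j.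
Proof.
move=> tau0 taus; rewrite /polydisc_weight /ck_weight !exprMn mulrACA.
rewrite ler_pM ?nagumo_ge ?mulr_ge0 ?exprn_ge0 ?invr_ge0 //.
by rewrite ler_wpM2l ?exprn_ge0 // lerXn2r // nnegrE (le_trans tau0).
Qed.

End weights.

(** * The normalizing equation for formal series *)

Section normalizing_equation.
Context (R : realType) (K : numFieldType) (N : abs_field R K).
Notation dseries := (nat -> nat -> K).
Implicit Types (a b : dseries) (z : bool -> dseries).

(** [shift_series a] is [(a(u, v) - a(u, 0)) / v], [axis_series a] is [a(u, 0)] and
    [int_shift a] is the primitive in [u] of [shift_series a] vanishing at [u = 0]. *)
Definition shift_series a : dseries := fun i j => a i j.+1.
Definition axis_series a : dseries := fun i j => if j is 0%N then a i 0%N else 0.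
Definition int_shift a : dseries :=
  fun i j => if i is i'.+1 then i'.+1%:R^-1 * a i' j.+1 else 0.
Definition deriv_fst a : dseries := fun i j => i.+1%:R * a i.+1 j.
Definition deriv_snd a : dseries := fun i j => j.+1%:R * a i j.+1.

Lemma sum_ord_shift_le n c (g : nat -> R) : (forall j, 0 <= g j) ->
  \sum_(j < n) g (j + c)%N <= \sum_(j < n + c) g j.
Proof.
move=> g0; rewrite addnC big_split_ord /=.
under eq_bigr do rewrite addnC.
by rewrite lerDr sumr_ge0.
Qed.

Lemma square_sum_shift_le n c (f : nat -> nat -> R) : (forall i j, 0 <= f i j) ->
  square_sum n (fun i j => f i (j + c)%N) <= square_sum (n + c) f.
Proof.
move=> f0; apply: (@le_trans _ _ (\sum_(i < n) \sum_(j < n + c) f i j)).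
  by apply: ler_sum => i _; exact: (sum_ord_shift_le n c (f0 i)).
apply: (sum_ord_le (f := fun i => \sum_(j < n + c) f i j)); last exact: leq_addr.
by move=> i; exact: sumr_ge0.
Qed.

Lemma square_sum_int_shift_le n c (f : nat -> nat -> R) : (forall i j, 0 <= f i j) ->
  square_sum n (fun i j => if i is i'.+1 then f i' (j + c)%N else 0) <=
  square_sum (n + c) f.
Proof.
move=> f0; apply: le_trans (square_sum_shift_le n c f0).
rewrite /square_sum; case: n => [|n]; first by rewrite !big_ord0.
rewrite big_ord_recl big1 // add0r [leRHS]big_ord_recr /= lerDl.
exact: sumr_ge0.
Qed.

Lemma wnorm_shift w a A c : 0 <= c -> (forall i j, 0 <= w i j) ->
  (forall i j, w i j <= c * w i j.+1) -> wnorm_le N w a A ->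
  wnorm_le N w (shift_series a) (c * A).
Proof.
move=> c0 w0 wc aA n.
apply: le_trans (ler_wpM2l c0 (aA (n + 1)%N)).
have f0 i j : 0 <= N (a i j) * w i j by rewrite mulr_ge0 ?absv_ge0.
apply: le_trans (ler_wpM2l c0 (square_sum_shift_le n 1 f0)).
rewrite -square_sumMl; apply: le_square_sum => i j.
by rewrite [leRHS]mulrCA /shift_series addn1 ler_wpM2l ?absv_ge0.
Qed.

Lemma wnorm_int_shift w a A c : 0 <= c -> (forall i j, 0 <= w i j) ->
  (forall i j, w i.+1 j <= c * i.+1%:R * w i j.+1) -> wnorm_le N w a A ->
  wnorm_le N w (int_shift a) (c * A).
Proof.
move=> c0 w0 wc aA n.
apply: le_trans (ler_wpM2l c0 (aA (n + 1)%N)).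
have f0 i j : 0 <= N (a i j) * w i j by rewrite mulr_ge0 ?absv_ge0.
apply: le_trans (ler_wpM2l c0 (square_sum_int_shift_le n 1 f0)).
rewrite -square_sumMl; apply: le_square_sum => -[|i] j.
  by rewrite absv0 mul0r mulr0.
rewrite absvM absvV absv_nat addn1.
have -> : i.+1%:R^-1 * N (a i j.+1) * w i.+1 j =
  N (a i j.+1) * (w i.+1 j / i.+1%:R) by ring.
rewrite [leRHS]mulrCA ler_wpM2l ?absv_ge0 // ler_pdivrMr ?ltr0Sn //.
by apply: le_trans (wc i j) _; rewrite mulrAC.
Qed.

Lemma wnorm_deriv_int_shift w a A c : 0 <= c -> (forall i j, 0 <= w i j) ->
  (forall i j, j.+1%:R * w i.+1 j <= c * i.+1%:R * w i j.+2) -> wnorm_le N w a A ->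
  wnorm_le N w (deriv_snd (int_shift a)) (c * A).
Proof.
move=> c0 w0 wc aA n.
apply: le_trans (ler_wpM2l c0 (aA (n + 2)%N)).
have f0 i j : 0 <= N (a i j) * w i j by rewrite mulr_ge0 ?absv_ge0.
apply: le_trans (ler_wpM2l c0 (square_sum_int_shift_le n 2 f0)).
rewrite -square_sumMl; apply: le_square_sum => -[|i] j.
  by rewrite /deriv_snd mulr0 absv0 mul0r mulr0.
rewrite /deriv_snd !absvM absvV !absv_nat addn2.
have -> : j.+1%:R * (i.+1%:R^-1 * N (a i j.+2)) * w i.+1 j =
  N (a i j.+2) * ((j.+1%:R * w i.+1 j) / i.+1%:R) by ring.
rewrite [leRHS]mulrCA ler_wpM2l ?absv_ge0 // ler_pdivrMr ?ltr0Sn //.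
by apply: le_trans (wc i j) _; rewrite mulrAC.
Qed.

Lemma wnorm_axis w a A : (forall i j, 0 <= w i j) -> wnorm_le N w a A ->
  wnorm_le N w (axis_series a) A.
Proof.
move=> w0 aA n; apply: le_trans (aA n); apply: le_square_sum => i [|j] //=.
by rewrite absv0 mul0r mulr_ge0 ?absv_ge0.
Qed.

Variable h : bool -> dseries.

(** The pair [(z true, z false)] is [(P, Q)], and the chart is the map gamma. *)
Definition chart z c : dseries := fun i j =>
  (if c then fst_series K i j else snd_series K i j) + int_shift (z c) i j.

(** With [xi = u + I S P] the first component of the equation for the chart is
    [(v + f) (1 + S P) + g d_v I S P = v + I S Q + H1]. The sum [f + v S P] occurring
    in it is taken as the unknown [P] itself, whose value at [v = 0] is then [f] and
    whose quotient by [v] is [S P]; similarly [Q = g + v S Q] in the second one. *)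
Definition normalizing_step z c : dseries := fun i j =>
  (if c then int_shift (z false) i j else 0) +
  comp_series (h c) (chart z true) (chart z false) i j -
  (cauchy_prod (axis_series (z false)) (deriv_snd (int_shift (z c))) i j +
   cauchy_prod (axis_series (z true)) (shift_series (z c)) i j).

Hypothesis h00 : forall c, h c 0%N 0%N = 0.
Hypothesis h01 : forall c, h c 0%N 1%N = 0.

(** Flatness makes the product [P(u, 0) S z] causal: it removes the terms containing
    [P(0, 0)] and, at [v = 0], the one containing the coefficient of [v] in [z]. *)
Definition flat z := forall c, z c 0%N 0%N = 0 /\ z c 0%N 1%N = 0.

Lemma chart00 z c : chart z c 0%N 0%N = 0.
Proof. by rewrite /chart; case: c; rewrite addr0. Qed.

Lemma cauchy_prod_row0 a b j : (forall l, a 0%N l = 0) -> cauchy_prod a b 0 j = 0.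
Proof. by move=> a0; rewrite /cauchy_prod big_ord1 big1 // => l _; rewrite a0 mul0r. Qed.

Lemma flat_normalizing_step z : flat z -> flat (normalizing_step z).
Proof.
move=> flatz c.
have z1 j : cauchy_prod (axis_series (z false)) (deriv_snd (int_shift (z c))) 0 j = 0.
  rewrite /cauchy_prod big_ord1 big1 // => l _.
  by rewrite /deriv_snd /= !mulr0.
have z2 j : cauchy_prod (axis_series (z true)) (shift_series (z c)) 0 j = 0.
  by apply: cauchy_prod_row0 => -[|l] //=; exact: (flatz true).1.
have x0 j : chart z true 0 j = 0 by rewrite /chart /= addr0.
rewrite /normalizing_step; split; rewrite z1 z2 !addr0 subr0.
  rewrite /comp_series add0n /square_sum !big_ord1 h00 mul0r.
  by case: c {z1 z2}; rewrite addr0.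
rewrite /comp_series add0n /square_sum !big_ord_recl !big_ord0 /= /bump /= h00 h01.
rewrite (@vanishes_below_monomial _ _ _ 1 1) ?chart00 //.
have -> : monomial_series (chart z true) (chart z false) (1 + 0) 0 0 1 = 0.
  by do 2!apply: cauchy_prod_row0 => ?.
by case: c {z1 z2}; rewrite !(mul0r, mulr0, addr0).
Qed.

(** The order in [u] comes first; for a given order, [P(u, 0)] has to be known before
    the other coefficients, where it occurs multiplied by [S z]. *)
Definition ck_rank i j := (i.*2 + (0 < j))%N.

Lemma ck_rank_mono i j k l : (i <= k)%N -> (j <= l)%N -> (ck_rank i j <= ck_rank k l)%N.
Proof. by rewrite /ck_rank => ik jl; case: j jl => [|j]; case: l => [|l] //= _; lia. Qed.

Lemma agree_int_shift n a a' : agree ck_rank n a a' ->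
  agree ck_rank n.+1 (int_shift a) (int_shift a').
Proof.
move=> aa [|i] j //= ijn; rewrite aa //.
by move: ijn; rewrite /ck_rank; case: j => [|j] /=; lia.
Qed.

Lemma agree_normalizing_step n z z' : flat z -> flat z' ->
  (forall c, agree ck_rank n (z c) (z' c)) ->
  forall c, agree ck_rank n.+1 (normalizing_step z c) (normalizing_step z' c).
Proof.
move=> flatz flatz' zz c.
have chartE c' : agree ck_rank n.+1 (chart z c') (chart z' c').
  by move=> i j ijn; rewrite /chart (agree_int_shift (zz c') ijn).
move=> i j ijn; rewrite /normalizing_step.
rewrite (agree_int_shift (zz false) ijn).
rewrite (agree_comp ck_rank_mono (h c) (chartE true) (chartE false) ijn).
have i2n : (i.*2 < n.+1)%N by apply: leq_ltn_trans ijn; exact: leq_addr.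
congr (_ - (_ + _)).
  apply: eq_bigr => k _; apply: eq_bigr => l _.
  have ki : (k <= i)%N by rewrite -ltnS.
  rewrite /deriv_snd; case ik : (i - k)%N => [|m] /=; first by rewrite !mulr0.
  have -> : axis_series (z false) k l = axis_series (z' false) k l.
    by case: (nat_of_ord l) => //=; apply: zz; rewrite /ck_rank /=; lia.
  by rewrite zz // /ck_rank /=; lia.
apply: eq_bigr => k _; apply: eq_bigr => -[[|l] lj] _ /=; last by rewrite !mul0r.
clear lj; have ki : (k <= i)%N by rewrite -ltnS.
rewrite subn0 /shift_series.
have [->|k0] := posnP k; first by rewrite (flatz true).1 (flatz' true).1 !mul0r.
have -> : z c (i - k)%N j.+1 = z' c (i - k)%N j.+1.
  by apply: zz; rewrite /ck_rank /=; lia.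
case: (ltnP k i) => [k_i|i_k].
  by rewrite zz // /ck_rank /=; lia.
have -> : (i - k = 0)%N by apply/eqP; rewrite subn_eq0.
case: j ijn {i2n} => [|j] ijn; first by rewrite (flatz' c).2 !mulr0.
by rewrite zz //; move: ijn; rewrite /ck_rank /=; lia.
Qed.

End normalizing_equation.

(** * Existence of convergent solutions *)

Section solutions.
Context (R : realType) (K : numFieldType) (N : abs_field R K).
Notation dseries := (nat -> nat -> K).
Implicit Types (a b : dseries) (z : bool -> dseries) (h : bool -> dseries).

Lemma wnorm_scale w w' a C theta : 0 <= theta ->
  (forall i j, a i j = 0 \/ w' i j <= theta * w i j) ->
  wnorm_le N w a C -> wnorm_le N w' a (theta * C).
Proof.
move=> theta0 w'w aC n; apply: le_trans (ler_wpM2l theta0 (aC n)).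
rewrite -square_sumMl; apply: le_square_sum => i j.
case: (w'w i j) => [->|ww]; first by rewrite absv0 !mul0r mulr0.
by rewrite mulrCA ler_wpM2l ?absv_ge0.
Qed.

(** Every monomial of [a] contains a factor [x], bounded by [A], or two factors [y],
    bounded by [B]. *)
Lemma wnorm_no_constant a C A B (r : R) : 0 < r -> 0 <= A <= r -> 0 <= B <= r ->
  a 0%N 0%N = 0 -> a 0%N 1%N = 0 -> wnorm_le N (polydisc_weight r r) a C ->
  wnorm_le N (polydisc_weight A B) a ((A / r + (B / r) ^+ 2) * C).
Proof.
move=> r0 /andP[A0 Ar] /andP[B0 Br] a00 a01; have r0' := ltW r0.
have Ar0 : 0 <= A / r by rewrite divr_ge0.
have Br0 : 0 <= (B / r) ^+ 2 by rewrite exprn_ge0 // divr_ge0.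
have powle (t : R) k : 0 <= t -> t <= r -> t ^+ k <= r ^+ k.
  by move=> t0 tr; rewrite lerXn2r ?nnegrE.
apply: wnorm_scale => [|[|i] j]; first exact: addr_ge0.
  case: j => [|[|j]]; [by left|by left|right].
  rewrite /polydisc_weight !expr0 !mul1r mulrDl.
  apply: (@le_trans _ _ ((B / r) ^+ 2 * r ^+ j.+2)).
    have -> : (B / r) ^+ 2 * r ^+ j.+2 = B ^+ 2 * r ^+ j.
      by rewrite !exprS; field; rewrite gt_eqF.
    by rewrite -[j.+2]addn2 exprD mulrC ler_wpM2l ?exprn_ge0 ?powle.
  by rewrite lerDr mulr_ge0 ?exprn_ge0.
right; rewrite /polydisc_weight mulrDl.
apply: (@le_trans _ _ (A / r * (r ^+ i.+1 * r ^+ j))).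
  have -> : A / r * (r ^+ i.+1 * r ^+ j) = A * (r ^+ i * r ^+ j).
    by rewrite exprS; field; rewrite gt_eqF.
  rewrite exprS -mulrA ler_wpM2l // ler_pM ?exprn_ge0 ?powle //.
by rewrite lerDl mulr_ge0 // mulr_ge0 ?exprn_ge0.
Qed.

Lemma wnorm_order2 a C (s r : R) : 0 < r -> 0 <= s <= r -> vanishes_below 2 a ->
  wnorm_le N (polydisc_weight r r) a C ->
  wnorm_le N (polydisc_weight s s) a ((s / r) ^+ 2 * C).
Proof.
move=> r0 /andP[s0 sr] a2; have r0' := ltW r0.
have sr0 : 0 <= (s / r) ^+ 2 by rewrite exprn_ge0 // divr_ge0.
apply: wnorm_scale => // i j; case: (ltnP (i + j) 2) => [|ij2].
  by move=> /a2; left.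
right; rewrite /polydisc_weight -!exprD -(subnK ij2) !exprD.
have -> : (s / r) ^+ 2 * (r ^+ (i + j - 2) * r ^+ 2) = r ^+ (i + j - 2) * s ^+ 2.
  by field; rewrite gt_eqF.
by rewrite ler_wpM2r ?exprn_ge0 // lerXn2r ?nnegrE.
Qed.

(** The bounds on an ordinary polydisc that allow every term of the equation to be
    evaluated there; [r] bounds the chart, whose values are substituted in series
    converging on the polydisc of radius [r]. *)
Definition normalizing_data z rho r M :=
  [/\ 0 < rho, forall c, wnorm_le N (polydisc_weight rho rho) (chart z c) r,
      forall c, wnorm_le N (polydisc_weight rho rho) (z c) M,
      forall c, wnorm_le N (polydisc_weight rho rho) (shift_series (z c)) M &
      forall c, wnorm_le N (polydisc_weight rho rho) (deriv_snd (int_shift (z c))) M].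

Lemma normalizing_solution h r C : 0 < r ->
  (forall c, wnorm_le N (polydisc_weight r r) (h c) C) ->
  (forall c, h c 0%N 0%N = 0) -> (forall c, h c 0%N 1%N = 0) ->
  exists z rho M, [/\ flat z,
    forall c i j, normalizing_step h z c i j = z c i j & normalizing_data z rho r M].
Proof.
move=> r0 hC h00 h01; have C0 := wnorm_ge0 (hC true).
(* The ball has radius s / 16. The terms of h of order at least 2 in y contribute
   O(s^2), whence the choice of s; all other terms but the last product contain
   tau and are made small with respect to s by the choice of tau. *)
pose s := r ^+ 2 / (8 * (8 * 8) * (C + r)).
have D0 : 0 < 8 * (8 * 8) * (C + r) by rewrite !mulr_gt0 // ltr_wpDl.
have s0 : 0 < s by rewrite divr_gt0 // exprn_gt0.
have sE : s * (8 * (8 * 8) * (C + r)) = r ^+ 2 by rewrite divfK // gt_eqF.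
pose tau := s * (3 * r / (64 * (r + 2 * C))).
have E0 : 0 < 64 * (r + 2 * C) by rewrite mulr_gt0 // ltr_wpDr // mulr_ge0.
have k0 : 0 < 3 * r / (64 * (r + 2 * C)) by rewrite divr_gt0 // mulr_gt0.
have tau0 : 0 < tau by rewrite mulr_gt0.
have tauE : tau * (64 * (r + 2 * C)) = s * (3 * r) by rewrite -mulrA divfK // gt_eqF.
have tau_s : tau <= s / 16.
  rewrite -(ler_pM2r E0) tauE.
  have : 0 <= s * C by rewrite mulr_ge0 // ltW.
  have : 0 < s * r by rewrite mulr_gt0.
  lra.
have s_r : s <= r / 8 / 8 / 8.
  have : 0 <= s * C by rewrite mulr_ge0 // ltW.
  move: sE s0; rewrite expr2 => sE s0 sC.
  rewrite -(ler_pM2r r0); lra.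
clearbody s tau.
have w0 i j : 0 <= ck_weight tau s i j by rewrite ck_weight_ge0 // ltW.
have wM : submultiplicative (ck_weight tau s) by apply: ck_submultiplicative; exact: ltW.
pose M := s / 16.
have M0 : 0 < M by rewrite divr_gt0.
pose good z := flat z /\ forall c, wnorm_le N (ck_weight tau s) (z c) M.
have q0 : 0 <= 2 / s by rewrite divr_ge0 // ltW.
have q1 : 0 <= 2 * tau / s by rewrite divr_ge0 ?mulr_ge0 // ltW.
have q2 : 0 <= 8 * tau / s ^+ 2 by rewrite divr_ge0 ?mulr_ge0 ?exprn_ge0 // ltW.
have tau0' := ltW tau0; have s0' := ltW s0.
have shiftM a : wnorm_le N (ck_weight tau s) a M ->
    wnorm_le N (ck_weight tau s) (shift_series a) (2 / s * M).
  by apply: wnorm_shift => // i j; exact: ck_weightSr.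
have intM a : wnorm_le N (ck_weight tau s) a M ->
    wnorm_le N (ck_weight tau s) (int_shift a) (2 * tau / s * M).
  apply: wnorm_int_shift => // i j; apply: le_trans (ck_weightSl _ _ _ _) _ => //.
  have le1 := ler_wpM2l tau0' (ck_weightSr i j tau0' s0).
  apply: le_trans le1 _.
  have -> : 2 * tau / s * i.+1%:R * ck_weight tau s i j.+1 =
    tau * (2 / s * ck_weight tau s i j.+1) * i.+1%:R by ring.
  by rewrite ler_peMr ?ler1n // mulr_ge0 // mulr_ge0.
have derivM a : wnorm_le N (ck_weight tau s) a M ->
    wnorm_le N (ck_weight tau s) (deriv_snd (int_shift a)) (8 * tau / s ^+ 2 * M).
  apply: wnorm_deriv_int_shift => // i j.
  apply: le_trans (ck_weight_derivative _ _ _ _) _ => //.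
  have -> : 8 * tau / s ^+ 2 * i.+1%:R * ck_weight tau s i j.+2 =
     4 * tau / s * i.+1%:R * (2 / s * ck_weight tau s i j.+2).
    by field; rewrite gt_eqF.
  rewrite ler_wpM2l ?ck_weightSr // mulr_ge0 // divr_ge0 // mulr_ge0 //.
(* Norms of the integral, of the shift and of the two products for z in the ball. *)
have eq1 : 2 * tau / s * M = tau / 8 by rewrite /M; field; rewrite gt_eqF.
have eq2 : 2 / s * M = 1 / 8 by rewrite /M; field; rewrite gt_eqF.
have eq3 : M * (8 * tau / s ^+ 2 * M) = tau / 32 by rewrite /M; field; rewrite gt_eqF.
pose A := tau + tau / 8; pose B := s + tau / 8.
have chartM z c : (forall c, wnorm_le N (ck_weight tau s) (z c) M) ->
    wnorm_le N (ck_weight tau s) (chart z c) (if c then A else B).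
  move=> zM; rewrite /A /B -eq1.
  have -> : (if c then tau + 2 * tau / s * M else s + 2 * tau / s * M) =
     (if c then tau else s) + 2 * tau / s * M by case: c.
  apply: wnormD (intM _ (zM c)) => //.
  case: c; [apply: (@wnorm_leW _ _ _ _ _ (ck_weight tau s 1 0)) |
            apply: (@wnorm_leW _ _ _ _ _ (ck_weight tau s 0 1))].
  - by rewrite /ck_weight expr1 expr0 mulr1 ler_piMr ?nagumo_le1.
  - exact: wnorm_unit.
  - by rewrite /ck_weight expr1 expr0 mul1r ler_piMr ?nagumo_le1.
  - exact: wnorm_unit.
have A_in : 0 <= A <= r by rewrite /A; apply/andP; split; lra.
have B_in : 0 <= B <= r by rewrite /B; apply/andP; split; lra.
have small : (A / r + (B / r) ^+ 2) * C <= 3 * s / 64 - 5 * tau / 32 + s / 128.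
  have C_tau : A / r * C <= 3 * s / 64 - 5 * tau / 32.
    rewrite mulrAC ler_pdivrMr // /A.
    have : 0 <= tau * r by rewrite mulr_ge0 // ltW.
    have : 0 <= tau * C by rewrite mulr_ge0.
    lra.
  have C_s : (B / r) ^+ 2 * C <= s / 128.
    rewrite expr_div_n mulrAC ler_pdivrMr ?exprn_gt0 //.
    have B2 : B ^+ 2 <= (2 * s) ^+ 2.
      by rewrite lerXn2r ?nnegrE /B //; lra.
    apply: le_trans (ler_wpM2r C0 B2) _.
    rewrite -sE.
    have : 0 <= s * s * C by rewrite !mulr_ge0.
    have : 0 <= s * s * r by rewrite !mulr_ge0 // ltW.
    have : 0 <= s * s by rewrite !mulr_ge0.
    rewrite expr2; lra.
  by rewrite mulrDl lerD.
have good0 : good (fun _ _ _ => 0).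
  split=> [c|c n] //; rewrite (@eq_square_sum _ _ _ (fun _ _ => 0)).
    by rewrite square_sum0 ltW.
  by move=> i j _ _; rewrite absv0 mul0r.
have good_step z : good z -> good (normalizing_step h z).
  move=> [flatz zM]; split=> [|c]; first exact: flat_normalizing_step.
  have b1 : wnorm_le N (ck_weight tau s) (fun i j =>
      if c then int_shift (z false) i j else 0) (tau / 8).
    case: c; first by rewrite -eq1; exact: intM.
    apply: (wnorm_leW (M := 0)); first by rewrite divr_ge0.
    move=> n; rewrite (@eq_square_sum _ _ _ (fun _ _ => 0)) ?square_sum0 //.
    by move=> i j _ _; rewrite absv0 mul0r.
  have b2 : wnorm_le N (ck_weight tau s)
      (comp_series (h c) (chart z true) (chart z false))
      (3 * s / 64 - 5 * tau / 32 + s / 128).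
    apply: wnorm_leW small _.
    apply: wnorm_comp (chartM z true zM) (chartM z false zM) _ => //.
    exact: wnorm_no_constant.
  have b3 : wnorm_le N (ck_weight tau s)
      (cauchy_prod (axis_series (z false)) (deriv_snd (int_shift (z c)))) (tau / 32).
    by rewrite -eq3; apply: wnorm_cauchy_prod => //; [exact: wnorm_axis|exact: derivM].
  have b4 : wnorm_le N (ck_weight tau s)
      (cauchy_prod (axis_series (z true)) (shift_series (z c))) (M * (1 / 8)).
    by rewrite -eq2; apply: wnorm_cauchy_prod => //; [exact: wnorm_axis|exact: shiftM].
  have b := wnormD w0 (wnormD w0 b1 b2) (wnormN (wnormD w0 b3 b4)).
  by apply: wnorm_leW b; rewrite /M; lra.
have [z [flatz zM] zE] : exists2 z, good z &
    forall c i j, normalizing_step h z c i j = z c i j.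
  apply: (@causal_fixpoint K ck_rank _ good _ good0 good_step).
    move=> z approx; split.
      move=> c; have [z' [flatz' _] zz'] := approx 2%N.
      by rewrite !zz' // /ck_rank.
    move=> c; apply: (wnorm_closed ck_rank_mono) => n.
    by have [z' [_ z'M] zz'] := approx n; exists (z' c).
  by move=> n z z' [flatz _] [flatz' _]; exact: agree_normalizing_step.
have le_w i j : polydisc_weight (tau / 2) (tau / 2) i j <= ck_weight tau s i j.
  by apply: ck_weight_ge => //; lra.
have Mle1 : M <= M + 1 by rewrite lerDl.
have M1 t : t <= 1 -> t <= M + 1 by move=> t1; rewrite (le_trans t1) // lerDr ltW.
exists z, (tau / 2), (M + 1); split=> //; split=> [|c|c|c|c].
- by rewrite divr_gt0.
- apply: wnorm_weight le_w _; apply: wnorm_leW (chartM z c zM).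
  by case: c; [case/andP: A_in|case/andP: B_in].
- exact: wnorm_weight le_w (wnorm_leW Mle1 (zM c)).
- apply: wnorm_weight le_w (wnorm_leW (M1 _ _) (shiftM _ (zM c))).
  by rewrite eq2; lra.
- apply: wnorm_weight le_w (wnorm_leW (M1 _ _) (derivM _ (zM c))).
  have -> : 8 * tau / s ^+ 2 * M = (tau / 2) / s by rewrite /M; field; rewrite gt_eqF.
  by rewrite ler_pdivrMr //; lra.
Qed.

(** ** Inversion of a series map tangent to the identity *)

Definition coord_series c : dseries := if c then fst_series K else snd_series K.

(** If [h] is the part of order at least 2 of a map, then the fixed points of this
    operator are its right inverses. *)
Definition inverse_step h z c : dseries := fun i j =>
  coord_series c i j - comp_series (h c) (z true) (z false) i j.

Lemma vanishes_below_comp a b b' : vanishes_below 2 a ->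
  b 0%N 0%N = 0 -> b' 0%N 0%N = 0 -> vanishes_below 2 (comp_series a b b').
Proof.
move=> a2 b0 b'0 i j ij2; rewrite /comp_series -[RHS](square_sum0 K (i + j).+1).
apply: eq_square_sum => k l _ _; case: (ltnP (k + l) 2) => kl2.
  by rewrite a2 ?mul0r.
by rewrite vanishes_below_monomial ?mulr0 // (leq_trans ij2).
Qed.

(** Without constant terms, a coefficient of a product involves only coefficients of
    strictly smaller degree of both factors. *)
Lemma agree_cauchy_prod_strict n a a' b b' :
  a 0%N 0%N = 0 -> a' 0%N 0%N = 0 -> b 0%N 0%N = 0 -> b' 0%N 0%N = 0 ->
  agree addn n a a' -> agree addn n b b' ->
  agree addn n.+1 (cauchy_prod a b) (cauchy_prod a' b').
Proof.
move=> a0 a'0 b0 b'0 aa bb i j ijn.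
apply: eq_bigr => k _; apply: eq_bigr => l _.
have ki : (k <= i)%N by rewrite -ltnS.
have lj : (l <= j)%N by rewrite -ltnS.
have [kl0|kl0] := posnP (k + l)%N.
  have [-> ->] : k = 0%N :> nat /\ l = 0%N :> nat by lia.
  by rewrite a0 a'0 !mul0r.
have [kl1|kl1] := posnP (i - k + (j - l))%N.
  have [-> ->] : (i - k = 0)%N /\ (j - l = 0)%N by lia.
  by rewrite b0 b'0 !mulr0.
by rewrite aa ?bb //; lia.
Qed.

Lemma agree_inverse_step h n z z' : (forall c, vanishes_below 2 (h c)) ->
  (forall c, z c 0%N 0%N = 0) -> (forall c, z' c 0%N 0%N = 0) ->
  (forall c, agree addn n (z c) (z' c)) ->
  forall c, agree addn n.+1 (inverse_step h z c) (inverse_step h z' c).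
Proof.
move=> h2 z0 z'0 zz c i j ijn; rewrite /inverse_step; congr (_ - _).
have pow0 (y : dseries) k : y 0%N 0%N = 0 -> pow_series y k.+1 0%N 0%N = 0.
  by move=> y0; rewrite (@vanishes_below_pow _ _ k.+1).
have pow_agree m c' k : agree addn m (z c') (z' c') ->
    agree addn m (pow_series (z c') k) (pow_series (z' c') k).
  by move=> ?; elim: k => //= k IHk; apply: agree_cauchy_prod => //; exact: leq_add.
have pow2 c' k : agree addn n.+1 (pow_series (z c') k.+2) (pow_series (z' c') k.+2).
  by apply: (agree_cauchy_prod_strict _ _ _ _ (zz c') (pow_agree n c' k.+1 (zz c')));
    rewrite ?pow0 ?z0 ?z'0.
apply: eq_square_sum => k l _ _; case: (ltnP (k + l) 2) => kl2.
  by rewrite h2 ?mul0r.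
congr (_ * _); case: k kl2 => [|[|k]] kl2.
- case: l kl2 => [|[|l]] // _.
  by apply: (agree_cauchy_prod leq_add) ijn => //; exact: pow2.
- case: l kl2 => [|l] // _.
  by apply: (agree_cauchy_prod_strict _ _ _ _ (pow_agree n _ _ (zz _))
    (pow_agree n _ _ (zz _)) ijn); rewrite ?pow0 ?z0 ?z'0.
case: l {kl2} => [|l].
  by apply: (agree_cauchy_prod leq_add) ijn => //; exact: pow2.
by apply: (agree_cauchy_prod_strict _ _ _ _ (pow_agree n _ _ (zz _))
    (pow_agree n _ _ (zz _)) ijn); rewrite ?pow0 ?z0 ?z'0.
Qed.

Lemma inverse_solution h r C : 0 < r ->
  (forall c, wnorm_le N (polydisc_weight r r) (h c) C) ->
  (forall c, vanishes_below 2 (h c)) ->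
  exists z s, [/\ 0 < s, forall c i j, inverse_step h z c i j = z c i j,
    forall c, wnorm_le N (polydisc_weight s s) (z c) r &
    forall c, vanishes_below 2 (fun i j => z c i j - coord_series c i j)].
Proof.
move=> r0 hC h2; have C0 := wnorm_ge0 (hC true).
(* On the ball of radius 2 s the step is at most s + (2 s / r)^2 C. *)
pose s := r ^+ 2 / (4 * (C + r)).
have D0 : 0 < 4 * (C + r) by rewrite mulr_gt0 // ltr_wpDl.
have s0 : 0 < s by rewrite divr_gt0 // exprn_gt0.
have sE : s * (4 * (C + r)) = r ^+ 2 by rewrite divfK // gt_eqF.
clearbody s; have s0' := ltW s0.
have s_r : 2 * s <= r.
  rewrite -(ler_pM2r r0) -expr2 -sE.
  have : 0 <= s * C by rewrite mulr_ge0.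
  have : 0 <= s * r by rewrite mulr_ge0 // ltW.
  lra.
have wM := polydisc_submultiplicative s0' s0'; have [w0 _ _] := wM.
pose good z := (forall c, z c 0%N 0%N = 0) /\
  forall c, wnorm_le N (polydisc_weight s s) (z c) (2 * s).
have good0 : good (fun _ _ _ => 0).
  split=> [c|c n] //; rewrite (@eq_square_sum _ _ _ (fun _ _ => 0)).
    by rewrite square_sum0 mulr_ge0.
  by move=> i j _ _; rewrite absv0 mul0r.
have good_step z : good z -> good (inverse_step h z).
  move=> [z0 zM]; split=> c.
    by rewrite /inverse_step vanishes_below_comp // subr0 /coord_series; case: c.
  have b1 : wnorm_le N (polydisc_weight s s) (coord_series c) s.
    rewrite /coord_series; case: c.
      have := @wnorm_unit _ _ N (polydisc_weight s s) 1 0 (w0 _ _).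
      by rewrite {2}/polydisc_weight expr1 expr0 mulr1.
    have := @wnorm_unit _ _ N (polydisc_weight s s) 0 1 (w0 _ _).
    by rewrite {2}/polydisc_weight expr1 expr0 mul1r.
  have b2 : wnorm_le N (polydisc_weight s s)
      (comp_series (h c) (z true) (z false)) ((2 * s / r) ^+ 2 * C).
    apply: wnorm_comp (zM true) (zM false) _ => //.
    by apply: wnorm_order2 => //; rewrite s_r mulr_ge0.
  apply: wnorm_leW (wnormD w0 b1 (wnormN b2)).
  rewrite expr_div_n mulrAC -lerBrDl ler_pdivrMr ?exprn_gt0 // -sE.
  have : 0 <= s * s * C by rewrite !mulr_ge0.
  have : 0 <= s * s * r by rewrite !mulr_ge0 // ltW.
  rewrite expr2; lra.
have [z [z0 zM] zE] : exists2 z, good z &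
    forall c i j, inverse_step h z c i j = z c i j.
  apply: (@causal_fixpoint K addn _ good _ good0 good_step).
    move=> z approx; split.
      by move=> c; have [z' [z'0 _] zz'] := approx 1%N; rewrite zz'.
    move=> c; apply: (wnorm_closed leq_add) => n.
    by have [z' [_ z'M] zz'] := approx n; exists (z' c).
  by move=> n z z' [z0 _] [z'0 _]; exact: agree_inverse_step.
exists z, s; split=> // c; first exact: wnorm_leW (zM c).
move=> i j ij2; rewrite -zE /inverse_step vanishes_below_comp //.
by rewrite subr0 subrr.
Qed.

End solutions.

(** * Convergent series as analytic germs *)

#[local] Existing Instance totally_filter.

Section topology.
Context (R : realType) (K : numFieldType) (N : abs_field R K).

Lemma absv_norm (V : normedModType K) (x : V) : `|x| = real_emb N (N `|x|).
Proof. by rewrite -(absvE N) normr_id. Qed.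

Lemma absv_norm_le (V : normedModType K) (x : V) e :
  (`|x| <= real_emb N e) = (N `|x| <= e).
Proof. by rewrite {1}absv_norm real_emb_le. Qed.

Lemma real_emb_gt0 e : (0 < real_emb N e) = (0 < e).
Proof. by rewrite -(rmorph0 (real_emb N)) (leW_mono (real_emb_le N)). Qed.

Lemma near_absvP (V : normedModType K) (x : V) (P : V -> Prop) :
  (\forall y \near x, P y) <->
  exists2 e, 0 < e & forall y, N `|y - x| <= e -> P y.
Proof.
split=> [/nbhs_normP[e /= e0 eP]|[e e0 eP]]; last first.
  apply/nbhs_normP; exists (real_emb N e); first by rewrite /= real_emb_gt0.
  by move=> y /= /ltW; rewrite distrC absv_norm_le; exact: eP.
have eE : e = real_emb N (N e) by rewrite -(absvE N) gtr0_norm.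
have e0' : 0 < N e by rewrite -real_emb_gt0 -eE.
exists (N e / 2); first by rewrite divr_gt0.
move=> y le_y; apply: eP; rewrite /ball_ /= distrC eE (absv_norm (y - x)).
rewrite (leW_mono (real_emb_le N)); apply: le_lt_trans le_y _.
by rewrite ltr_pdivrMr // ltr_pMr // ltr1n.
Qed.

Lemma absv_entry m n (M : 'M[K]_(m, n)) i j : N (M i j) <= N `|M|.
Proof.
rewrite -(real_emb_le N) -absv_norm -(absvE N).
rewrite [leRHS]/Num.norm /= mx_normE -[leLHS]nngE num_le.
exact: (le_bigmax _ (fun i => `|M i.1 i.2|%:nng) (i, j)).
Qed.

Lemma absv_mx_le m n (M : 'M[K]_(m, n)) e : 0 <= e ->
  (forall i j, N (M i j) <= e) -> N `|M| <= e.
Proof.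
move=> e0 le_e; have normE : `|M| = mx_norm M by [].
have [M0|/mx_norm_neq0[[i j] /= M0]] := eqVneq (mx_norm M) 0.
  by rewrite normE M0 absv0.
rewrite normE M0.
by rewrite -(real_emb_le N) -(absvE N) normr_id (absvE N) real_emb_le le_e.
Qed.

(** ** Unconditional convergence along finite sets of indices *)

Definition square_fset n : {fset nat * nat} :=
  [fset k in [seq (i, j) | i <- iota 0 n, j <- iota 0 n]]%fset.

Lemma mem_square_fset n i j : ((i, j) \in square_fset n) = (i < n)%N && (j < n)%N.
Proof.
rewrite in_fset /= -[LHS]/((i, j) \in [seq (i, j) | i <- iota 0 n, j <- iota 0 n]).
apply/allpairsP/idP => [[[i' j']] /= []|/andP[i_n j_n]].
  by rewrite !mem_iota /= => i_n j_n [-> ->]; rewrite i_n.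
by exists (i, j); rewrite !mem_iota.
Qed.

Lemma square_fset_mono m n : (m <= n)%N -> (square_fset m `<=` square_fset n)%fset.
Proof.
move=> mn; apply/fsubsetP => -[i j]; rewrite !mem_square_fset => /andP[im jm].
by rewrite !(leq_trans _ mn).
Qed.

Lemma sub_square_fset (A : {fset nat * nat}) : exists n, (A `<=` square_fset n)%fset.
Proof.
pose n := \max_(k <- enum_fset A) (maxn k.1 k.2).+1.
exists n; apply/fsubsetP => -[i j] ijA; rewrite mem_square_fset -gtn_max.
have := @leq_bigmax_seq _ (enum_fset A) xpredT (fun k => (maxn k.1 k.2).+1) (i, j).
by apply.
Qed.

Lemma sum_fset_square (V : zmodType) (f : nat -> nat -> V) (A : {fset nat * nat}) n :
  (A `<=` square_fset n)%fset ->
  partial_sum (fun k => f k.1 k.2) A =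
  square_sum n (fun i j => if (i, j) \in A then f i j else 0).
Proof.
move=> /fsubsetP A_n.
rewrite /partial_sum -(big_seq_fsetE _ _ xpredT (fun k => f k.1 k.2)).
transitivity (\sum_(k <- enum_fset A) square_sum n (fun i j =>
    if (i == k.1) && (j == k.2) then f i j else 0)).
  rewrite [RHS]big_seq [LHS]big_seq; apply: eq_bigr => -[i j] /A_n.
  rewrite mem_square_fset /= => ijn.
  rewrite /square_sum; case/andP: ijn => i_n j_n.
  rewrite (bigD1 (Ordinal i_n)) //= (bigD1 (Ordinal j_n)) //= !eqxx /=.
  rewrite [X in _ + X + _]big1 ?addr0; last by move=> j'; rewrite -val_eqE /= => /negPf->.
  rewrite big1 ?addr0 // => i'; rewrite -val_eqE /= => /negPf->.
  by rewrite big1.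
rewrite /square_sum exchange_big; apply: eq_bigr => i _ /=.
rewrite exchange_big; apply: eq_bigr => j _ /=.
rewrite -big_mkcond /=; case: ifPn => ijA.
  rewrite -big_filter.
  rewrite (eq_filter (a2 := pred1 (i : nat, j : nat))); last first.
    by move=> k; rewrite /= -pair_eqE /pair_eq /= eq_sym (eq_sym (k.2)).
  by rewrite filter_pred1_uniq ?fset_uniq // big_seq1.
rewrite big_seq_cond big1 // => -[k l] /= /andP[klA /andP[/eqP ik /eqP jl]].
by case/negP: ijA; rewrite ik jl.
Qed.

Lemma partial_sum_square_fset (V : zmodType) (f : nat -> nat -> V) n :
  partial_sum (fun k => f k.1 k.2) (square_fset n) = square_sum n f.
Proof.
rewrite (sum_fset_square f (fsubset_refl _)); apply: eq_square_sum => i j i_n j_n.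
by rewrite mem_square_fset i_n j_n.
Qed.

Lemma double_sum_totally (f : nat -> nat -> K) M s :
  abs_bounded N f M -> double_sum N f s ->
  partial_sum (fun k => f k.1 k.2) @ totally --> s.
Proof.
move=> fM fs; apply/cvgrPdist_le => e e0.
have eE : e = real_emb N (N e) by rewrite -(absvE N) gtr0_norm.
have e2 : 0 < N e / 2 by rewrite divr_gt0 // -real_emb_gt0 -eE.
have [n1 fn1] := fs _ e2; have [n2 tail] := abs_bounded_tail fM e2.
pose n0 := maxn n1 n2.
exists (square_fset n0) => //= B n0B; rewrite eE (absvE N) real_emb_le.
have [n B_n] := sub_square_fset B.
rewrite (splitr (N e)) absv_distC.
have -> : partial_sum (fun k => f k.1 k.2) B - s =
  (square_sum n0 f - s) + (partial_sum (fun k => f k.1 k.2) B - square_sum n0 f) by ring.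
apply: le_trans (absvD _ _ _) _; apply: lerD; first by rewrite fn1 // leq_maxl.
have n0n := fsubset_trans n0B B_n.
rewrite -(partial_sum_square_fset f) (sum_fset_square f B_n) (sum_fset_square f n0n).
rewrite -square_sumN -square_sumD.
apply: le_trans (absv_square_sum _ _ _) _.
apply: le_trans (tail n (fun i j => ((i, j) \in B) && ((i, j) \notin square_fset n0)) _).
  apply: le_square_sum => i j.
  case: (boolP ((i, j) \in square_fset n0)) => [ij|_].
    by rewrite (fsubsetP n0B _ ij) subrr absv0.
  by case: ifP => _; rewrite /= subr0 ?absv0.
move=> i j i2 j2; rewrite mem_square_fset negb_and negbK orbC.
by rewrite !(leq_trans _ (leq_maxr n1 n2)).
Qed.

(** The terms outside a finite set realizing the limit up to 1 are differences of two
    partial sums containing that set. *)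
Lemma totally_double_sum (f : nat -> nat -> K) s :
  partial_sum (fun k => f k.1 k.2) @ totally --> s ->
  double_sum N f s /\ exists C, forall i j, N (f i j) <= C.
Proof.
move=> /cvgrPdist_le fs.
have near_s e : 0 < e -> exists A : {fset nat * nat}, forall B, (A `<=` B)%fset ->
    N (partial_sum (fun k => f k.1 k.2) B - s) <= e.
  move=> e0; have e0' : 0 < real_emb N e by rewrite real_emb_gt0.
  have [A _ AP] := fs _ e0'; exists A => B AB.
  by have := AP B AB; rewrite /= (absvE N) real_emb_le absv_distC.
split=> [e e0|].
  have [A AP] := near_s e e0; have [n0 An0] := sub_square_fset A.
  exists n0 => n n0n; rewrite -partial_sum_square_fset AP //.
  exact: fsubset_trans An0 (square_fset_mono n0n).
have [A AP] := near_s 1 ltr01.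
exists (2 + \sum_(k <- enum_fset A) N (f k.1 k.2)) => i j.
have S0 : 0 <= \sum_(k <- enum_fset A) N (f k.1 k.2).
  by apply: sumr_ge0 => k _; exact: absv_ge0.
case: (boolP ((i, j) \in A)) => ijA.
  rewrite (big_rem _ ijA) /= addrCA lerDl addr_ge0 // sumr_ge0 // => k _.
  exact: absv_ge0.
apply: (@le_trans _ _ 2); last by rewrite lerDl.
have AB : (A `<=` (i, j) |` A)%fset by exact: fsubsetU1.
have := AP _ AB; have := AP _ (fsubset_refl A).
rewrite /partial_sum -!(big_seq_fsetE _ _ xpredT (fun k => f k.1 k.2)).
rewrite big_fsetU1 //=; set S := \sum_(_ <- _) _ => le1 le2.
have -> : f i j = (f i j + S - s) - (S - s) by ring.
by apply: le_trans (absvB _ _ _) _; rewrite -[2]/(1 + 1) lerD.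
Qed.

(** Abel: halving the radius inserts a geometric factor in each variable. *)
Lemma wnorm_bounded_terms (a : nat -> nat -> K) (r C : R) : 0 < r ->
  (forall i j, N (a i j) * (r ^+ i * r ^+ j) <= C) ->
  wnorm_le N (polydisc_weight (r / 2) (r / 2)) a (4 * C).
Proof.
move=> r0 aC n.
have C0 : 0 <= C.
  by apply: le_trans (aC 0%N 0%N); rewrite !mulr_ge0 ?absv_ge0 ?exprn_ge0 ?ltW.
apply: (@le_trans _ _ (square_sum n (fun i j => (2^-1 ^+ i * 2^-1 ^+ j) * C))).
  apply: le_square_sum => i j; rewrite /polydisc_weight !exprMn.
  have -> : N (a i j) * (r ^+ i * 2^-1 ^+ i * (r ^+ j * 2^-1 ^+ j)) =
    2^-1 ^+ i * 2^-1 ^+ j * (N (a i j) * (r ^+ i * r ^+ j)) by ring.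
  by rewrite ler_wpM2l // mulr_ge0 // exprn_ge0 // invr_ge0.
rewrite square_sumMr ler_wpM2r // /square_sum.
have geom m : \sum_(i < m) 2^-1 ^+ i <= 2 :> R.
  have -> : \sum_(i < m) 2^-1 ^+ i = 2 - 2 * 2^-1 ^+ m :> R.
    elim: m => [|m IHm]; first by rewrite big_ord0 expr0; ring.
    by rewrite big_ord_recr /= IHm exprS; field.
  by rewrite gerBl mulr_ge0 // exprn_ge0 // invr_ge0.
under eq_bigr do rewrite -mulr_sumr.
rewrite -mulr_suml; have -> : 4 = 2 * 2 :> R by ring.
by rewrite ler_pM // sumr_ge0 // => i _; rewrite exprn_ge0 // invr_ge0.
Qed.

(** ** Evaluation and analytic germs *)

Definition series_val (a : nat -> nat -> K) (x y : K) : K :=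
  get [set s | has_val N a x y s].

Lemma series_valP a r s M x y : wnorm_le N (polydisc_weight r s) a M ->
  N x <= r -> N y <= s -> has_val N a x y (series_val a x y).
Proof.
move=> aM xr ys; have [t aval] := has_val_exists xr ys aM.
exact: (@getPex _ [set s | has_val N a x y s] (ex_intro _ t aval)).
Qed.

Lemma series_valE a x y t : has_val N a x y t -> series_val a x y = t.
Proof.
move=> aval; apply: (has_val_unique _ aval).
exact: (@getPex _ [set s | has_val N a x y s] (ex_intro _ t aval)).
Qed.

Lemma analytic_series_val a r M : 0 < r -> wnorm_le N (polydisc_weight r r) a M ->
  forall h, (\forall p \near (0 : 'rV[K]_2), h p = series_val a (cx p) (cy p)) ->
  analytic_germ2 h.
Proof.
move=> r0 aM h /near_absvP[e e0 hE]; exists (fun k => a k.1 k.2).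
apply/near_absvP; exists (Num.min e r); first by rewrite lt_min e0 r0.
move=> p; rewrite le_min subr0 => /andP[pe pr].
have xr : N (cx p) <= r := le_trans (absv_entry p ord0 ord0) pr.
have yr : N (cy p) <= r := le_trans (absv_entry p ord0 ord_max) pr.
rewrite hE ?subr0 //.
exact: (double_sum_totally (wnorm_abs_bounded xr yr aM) (series_valP aM xr yr)).
Qed.

(** Convergence at the single diagonal point [(e, e)] bounds the terms there, which
    gives absolute convergence on a smaller polydisc. *)
Lemma analytic_germ2P h : analytic_germ2 h -> exists a r M,
  [/\ 0 < r, wnorm_le N (polydisc_weight r r) a M &
      forall p, N (cx p) <= r -> N (cy p) <= r -> has_val N a (cx p) (cy p) (h p)].
Proof.
move=> [a /near_absvP[e e0 ah]].
pose b i j := a (i, j).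
have bh p : N (cx p) <= e -> N (cy p) <= e ->
    has_val N b (cx p) (cy p) (h p) /\
    exists C, forall i j, N (b i j * (cx p ^+ i * cy p ^+ j)) <= C.
  move=> pxe pye.
  apply: totally_double_sum (fun i j => b i j * (cx p ^+ i * cy p ^+ j)) _ _.
  have -> : (fun k => b k.1 k.2 * (cx p ^+ k.1 * cy p ^+ k.2)) =
            (fun k => a k * (cx p ^+ k.1 * cy p ^+ k.2)).
    by apply/funext => -[].
  apply: ah; rewrite subr0; apply: absv_mx_le (ltW e0) _ => i j.
  rewrite (ord1 i); case: (unliftP ord0 j) => [j' ->|-> //].
  by rewrite (ord1 j') (_ : lift ord0 ord0 = ord_max) //; exact: val_inj.
pose p0 : 'rV[K]_2 := const_mx (real_emb N e).
have p0x : N (cx p0) <= e by rewrite /cx mxE absv_emb // ltW.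
have p0y : N (cy p0) <= e by rewrite /cy mxE absv_emb // ltW.
have [_ [C bC]] := bh p0 p0x p0y.
have bM : wnorm_le N (polydisc_weight (e / 2) (e / 2)) b (4 * C).
  apply: wnorm_bounded_terms => // i j.
  by have := bC i j; rewrite /cx /cy !mxE !absvM !absvX !absv_emb // ltW.
have e2 : e / 2 <= e by rewrite ler_pdivrMr // ler_pMr // ler1n.
exists b, (e / 2), (4 * C); split=> // [|p px py]; first by rewrite divr_gt0.
by have [] := bh p (le_trans px e2) (le_trans py e2).
Qed.

End topology.

(** * Derivatives of convergent series *)

Section power_estimates.
Context (R : realType) (K : numFieldType) (N : abs_field R K).
Variables (rho e : R).
Hypotheses (rho0 : 0 <= rho) (e0 : 0 <= e).

Lemma pow_lipschitz sigma x s i : 0 <= sigma <= 1 -> N x <= rho -> N s <= sigma * e ->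
  N ((x + s) ^+ i - x ^+ i) <= sigma * ((rho + e) ^+ i - rho ^+ i).
Proof.
move=> /andP[s0 s1] xr se; elim: i => [|i IHi].
  by rewrite !expr0 !subrr absv0 mulr0.
have -> : (x + s) ^+ i.+1 - x ^+ i.+1 = (x + s) * ((x + s) ^+ i - x ^+ i) + s * x ^+ i.
  by rewrite !exprS; ring.
have -> : sigma * ((rho + e) ^+ i.+1 - rho ^+ i.+1) =
  (rho + e) * (sigma * ((rho + e) ^+ i - rho ^+ i)) + sigma * e * rho ^+ i.
  by rewrite !exprS; ring.
apply: le_trans (absvD _ _ _) _; rewrite !absvM absvX lerD //.
  rewrite ler_pM ?absv_ge0 //; apply: le_trans (absvD _ _ _) _.
  rewrite lerD //; apply: le_trans se _.
  by rewrite ler_piMl.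
by rewrite ler_pM ?exprn_ge0 ?absv_ge0 // lerXn2r ?nnegrE ?absv_ge0.
Qed.

Lemma pow_quadratic sigma x s i : 0 <= sigma <= 1 -> N x <= rho -> N s <= sigma * e ->
  N ((x + s) ^+ i - x ^+ i - i%:R * x ^+ i.-1 * s) <=
  sigma ^+ 2 * ((rho + e) ^+ i - rho ^+ i).
Proof.
move=> s01 xr se; have /andP[s0 s1] := s01; elim: i => [|i IHi].
  by rewrite !expr0 !subrr !mul0r subr0 absv0 mulr0.
have -> : (x + s) ^+ i.+1 - x ^+ i.+1 - i.+1%:R * x ^+ i.+1.-1 * s =
  x * ((x + s) ^+ i - x ^+ i - i%:R * x ^+ i.-1 * s) + s * ((x + s) ^+ i - x ^+ i).
  rewrite !exprS /= -natr1; case: i {IHi} => [|i] /=; last by rewrite !exprS; ring.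
  by rewrite !expr0; ring.
apply: le_trans (absvD _ _ _) _; rewrite !absvM.
apply: (@le_trans _ _ (rho * (sigma ^+ 2 * ((rho + e) ^+ i - rho ^+ i)) +
  sigma * e * (sigma * ((rho + e) ^+ i - rho ^+ i)))).
  by rewrite lerD // ler_pM ?absv_ge0 // pow_lipschitz.
have -> : rho * (sigma ^+ 2 * ((rho + e) ^+ i - rho ^+ i)) +
  sigma * e * (sigma * ((rho + e) ^+ i - rho ^+ i)) =
  sigma ^+ 2 * ((rho + e) ^+ i.+1 - (rho + e) * rho ^+ i) by rewrite !exprS; ring.
rewrite ler_wpM2l ?exprn_ge0 // lerD2l lerN2 exprS ler_wpM2r ?exprn_ge0 //.
by rewrite lerDl.
Qed.

Lemma pow_derivative x i : N x <= rho -> N (i%:R * x ^+ i.-1) * e <= (rho + e) ^+ i.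
Proof.
move=> xr; apply: (@le_trans _ _ (i%:R * rho ^+ i.-1 * e)).
  by rewrite ler_wpM2r // absvM absv_nat absvX ler_wpM2l // lerXn2r ?nnegrE ?absv_ge0.
apply: (@le_trans _ _ ((rho + e) ^+ i - rho ^+ i)); last by rewrite gerBl exprn_ge0.
elim: i => [|i IHi]; first by rewrite !mul0r !expr0 subrr.
have -> : i.+1%:R * rho ^+ i.+1.-1 * e = rho * (i%:R * rho ^+ i.-1 * e) + e * rho ^+ i.
  rewrite -natr1 /=; case: i {IHi} => [|i] /=; last by rewrite !exprS; ring.
  by rewrite !expr0; ring.
have -> : (rho + e) ^+ i.+1 - rho ^+ i.+1 =
  rho * ((rho + e) ^+ i - rho ^+ i) + e * (rho + e) ^+ i by rewrite !exprS; ring.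
rewrite lerD ?ler_wpM2l // lerXn2r ?nnegrE ?addr_ge0 //.
by rewrite lerDl.
Qed.

End power_estimates.

Section derivatives.
Context (R : realType) (K : numFieldType) (N : abs_field R K).
Notation dseries := (nat -> nat -> K).
Implicit Types (a : dseries) (f : nat -> nat -> K).

Lemma double_sum_swap f s : double_sum N f s -> double_sum N (fun i j => f j i) s.
Proof.
apply: (tends_near (n0 := 0%N)) => n _.
by rewrite /square_sum exchange_big.
Qed.

Lemma abs_bounded_swap f M : abs_bounded N f M -> abs_bounded N (fun i j => f j i) M.
Proof. by move=> fM n; rewrite /square_sum exchange_big; exact: fM. Qed.

(** Termwise differentiation shifts an index, and the squares of the shifted family
    are rectangles of the original one: they differ by a piece of its tail. *)
Lemma double_sum_drop_row f M s : abs_bounded N f M -> (forall j, f 0%N j = 0) ->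
  double_sum N f s -> double_sum N (fun i j => f i.+1 j) s.
Proof.
move=> fM f0 fs e e0; have e2 : 0 < e / 2 by rewrite divr_gt0.
have [n1 fn1] := fs _ e2; have [n2 tail] := abs_bounded_tail fM e2.
exists (maxn n1 n2) => n; rewrite geq_max => /andP[n1n n2n].
have shiftE : square_sum n (fun i j => f i.+1 j) =
    square_sum n.+1 (fun i j => if (j < n)%N then f i j else 0).
  rewrite /square_sum big_ord_recl /= [X in _ = X + _]big1 ?add0r; last first.
    by move=> j _; rewrite f0; case: ifP.
  apply: eq_bigr => i _; rewrite big_ord_recr /= ltnn addr0.
  by apply: eq_bigr => j _; rewrite ltn_ord.
have -> : square_sum n (fun i j => f i.+1 j) - s =
  (square_sum n f - s) + (square_sum n (fun i j => f i.+1 j) - square_sum n f) by ring.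
rewrite (splitr e); apply: le_trans (absvD _ _ _) _; rewrite lerD ?fn1 //.
rewrite shiftE (square_sum_restrict f (leqnSn n)) -square_sumN -square_sumD.
apply: le_trans (absv_square_sum _ _ _) _.
apply: le_trans (tail n.+1 (fun i j => (n <= i)%N && (j < n)%N) _).
  apply: le_square_sum => i j; case: (ltnP j n) => _; rewrite ?andbT ?andbF /=.
    by case: (ltnP i n) => _; rewrite /= ?subrr ?subr0 ?absv0.
  by rewrite subrr absv0.
by move=> i j i2 _; rewrite negb_and -ltnNge (leq_trans i2).
Qed.

(** The second order remainder of each monomial on the smaller polydisc is
    quadratic in the relative size of the increment, with the value of the monomial
    on the larger polydisc as a constant: summation gives the differentiability. *)
Lemma series_quadratic a M (rho e : R) x y : 0 <= rho -> 0 < e ->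
  wnorm_le N (polydisc_weight (rho + e) (rho + e)) a M -> N x <= rho -> N y <= rho ->
  exists A B, [/\ has_val N (deriv_fst a) x y A, has_val N (deriv_snd a) x y B &
    forall sigma s t u v, 0 <= sigma <= 1 -> N s <= sigma * e -> N t <= sigma * e ->
      has_val N a x y u -> has_val N a (x + s) (y + t) v ->
      N (v - u - (A * s + B * t)) <= sigma ^+ 2 * (3 * M)].
Proof.
move=> rho0 e0 aM xr yr; have e0' := ltW e0; have re0 := addr_ge0 rho0 e0'.
pose gx i j := a i j * (i%:R * x ^+ i.-1 * y ^+ j).
pose gy i j := a i j * (x ^+ i * (j%:R * y ^+ j.-1)).
have powr (z : K) i : N z <= rho -> N z ^+ i <= (rho + e) ^+ i.
  by move=> zr; rewrite lerXn2r ?nnegrE ?absv_ge0 // (le_trans zr) // lerDl.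
have dpow (z : K) i : N z <= rho -> N (i%:R * z ^+ i.-1) <= (rho + e) ^+ i / e.
  by move=> zr; rewrite ler_pdivlMr // pow_derivative.
have gxM : abs_bounded N gx (e^-1 * M).
  move=> n; apply: le_trans (ler_wpM2l _ (aM n)); last by rewrite invr_ge0.
  rewrite -square_sumMl; apply: le_square_sum => i j.
  rewrite absvM [leRHS]mulrCA ler_wpM2l ?absv_ge0 // absvM (absvX N y).
  rewrite /polydisc_weight mulrA [e^-1 * _]mulrC.
  by rewrite ler_pM ?absv_ge0 ?exprn_ge0 ?dpow ?powr ?absv_ge0.
have gyM : abs_bounded N gy (e^-1 * M).
  move=> n; apply: le_trans (ler_wpM2l _ (aM n)); last by rewrite invr_ge0.
  rewrite -square_sumMl; apply: le_square_sum => i j.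
  rewrite absvM [leRHS]mulrCA ler_wpM2l ?absv_ge0 // absvM (absvX N x).
  rewrite /polydisc_weight mulrCA [e^-1 * _]mulrC.
  by rewrite ler_pM ?absv_ge0 ?exprn_ge0 ?dpow ?powr ?absv_ge0.
have [A gxA] := double_sum_exists gxM; have [B gyB] := double_sum_exists gyM.
exists A, B; split.
- have gx0 j : gx 0%N j = 0 by rewrite /gx !mul0r mulr0.
  apply: (tends_near (n0 := 0%N)) (double_sum_drop_row gxM gx0 gxA) => n _.
  by apply: eq_square_sum => i j _ _; rewrite /gx /deriv_fst /=; ring.
- have gy0 j : gy j 0%N = 0 by rewrite /gy mul0r !mulr0.
  apply: (tends_near (n0 := 0%N)) (double_sum_swap (double_sum_drop_row
    (abs_bounded_swap gyM) gy0 (double_sum_swap gyB))) => n _.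
  by apply: eq_square_sum => i j _ _; rewrite /gy /deriv_snd /=; ring.
move=> sigma s t u v s01 se te au av; have /andP[s0 s1] := s01.
have sum := double_sumD (double_sumD av (double_sumN au))
  (double_sumN (double_sumD (double_sumMl s gxA) (double_sumMl t gyB))).
rewrite [A * s]mulrC [B * t]mulrC; apply: double_sum_le sum _ => n.
rewrite mulrA; apply: le_trans (ler_wpM2l _ (aM n)); last first.
  by rewrite mulr_ge0 ?exprn_ge0.
rewrite -square_sumMl; apply: le_square_sum => i j.
set Xi := (x + s) ^+ i; set Yj := (y + t) ^+ j.
set dX := i%:R * x ^+ i.-1; set dY := j%:R * y ^+ j.-1.
have -> : a i j * (Xi * Yj) + - (a i j * (x ^+ i * y ^+ j)) + - (s * gx i j + t * gy i j)
  = a i j * ((Xi - x ^+ i - dX * s) * y ^+ j + x ^+ i * (Yj - y ^+ j - dY * t) +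
             (Xi - x ^+ i) * (Yj - y ^+ j)).
  by rewrite /gx /gy -/dX -/dY; ring.
rewrite absvM [leRHS]mulrCA ler_wpM2l ?absv_ge0 // /polydisc_weight.
set P := (rho + e) ^+ i; set Q := (rho + e) ^+ j.
have P0 : 0 <= P by rewrite exprn_ge0.
have Q0 : 0 <= Q by rewrite exprn_ge0.
have drop k : (rho + e) ^+ k - rho ^+ k <= (rho + e) ^+ k by rewrite gerBl exprn_ge0.
have b1 : N ((Xi - x ^+ i - dX * s) * y ^+ j) <= sigma ^+ 2 * P * Q.
  rewrite absvM absvX ler_pM ?absv_ge0 ?exprn_ge0 ?absv_ge0 ?powr //.
  apply: le_trans (pow_quadratic rho0 e0' i s01 xr se) _.
  by rewrite ler_wpM2l ?exprn_ge0 ?drop.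
have b2 : N (x ^+ i * (Yj - y ^+ j - dY * t)) <= P * (sigma ^+ 2 * Q).
  rewrite absvM absvX ler_pM ?absv_ge0 ?exprn_ge0 ?absv_ge0 ?powr //.
  apply: le_trans (pow_quadratic rho0 e0' j s01 yr te) _.
  by rewrite ler_wpM2l ?exprn_ge0 ?drop.
have b3 : N ((Xi - x ^+ i) * (Yj - y ^+ j)) <= sigma * P * (sigma * Q).
  rewrite absvM ler_pM ?absv_ge0 //.
    apply: le_trans (pow_lipschitz rho0 e0' i s01 xr se) _.
    by rewrite ler_wpM2l ?drop.
  apply: le_trans (pow_lipschitz rho0 e0' j s01 yr te) _.
  by rewrite ler_wpM2l ?drop.
apply: le_trans (absvD _ _ _) _.
apply: le_trans (lerD (le_trans (absvD _ _ _) (lerD b1 b2)) b3) _.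
by rewrite le_eqVlt; apply/orP; left; apply/eqP; ring.
Qed.

(** ** Differentials of maps of the plane *)

Lemma absv_mulmx_le m n (v : 'rV[K]_m) (J : 'M[K]_(m, n)) :
  N `|v *m J| <= N `|v| * \sum_i \sum_j N (J i j).
Proof.
apply: absv_mx_le => [|i j].
  by rewrite mulr_ge0 ?absv_ge0 // sumr_ge0 // => i _; rewrite sumr_ge0 // => j _; rewrite absv_ge0.
rewrite mxE; apply: le_trans (absv_sum _ _ _ _) _; rewrite mulr_sumr.
apply: ler_sum => k _; rewrite absvM ler_pM ?absv_ge0 ?absv_entry //.
by rewrite (bigD1 j) //= lerDl sumr_ge0 // => l _; rewrite absv_ge0.
Qed.

Lemma mulmxr_continuous m n (J : 'M[K]_(m, n)) :
  continuous (mulmxr J : 'rV[K]_m -> 'rV[K]_n).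
Proof.
move=> v; apply/(@cvgrPdist_le _ _ _ (nbhs v)) => eps eps0.
have epsE : eps = real_emb N (N eps) by rewrite -(absvE N) gtr0_norm.
have eps0' : 0 < N eps by rewrite -(real_emb_gt0 N) -epsE.
set S := \sum_i \sum_j N (J i j).
have S0 : 0 <= S by rewrite sumr_ge0 // => i _; rewrite sumr_ge0 // => j _; rewrite absv_ge0.
have S1 : 0 < S + 1 by rewrite ltr_wpDl.
apply: (near_absvP N v _).2; exists (N eps / (S + 1)); first by rewrite divr_gt0.
move=> w wv; rewrite /= -mulmxBl epsE absv_norm_le.
apply: le_trans (absv_mulmx_le _ _) _; rewrite -/S distrC.
move: wv; rewrite ler_pdivlMr // => wv; apply: le_trans wv.
by rewrite ler_wpM2l ?absv_ge0 // lerDl.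
Qed.

Lemma quadratic_differentiable (V W : normedModType K) (G : V -> W) p
    (df : {linear V -> W}) C e : continuous df -> 0 < e ->
  (forall d, N `|d| <= e -> N `|G (d + p) - G p - df d| <= C * N `|d| ^+ 2) ->
  differentiable G p /\ 'd G p = df :> (V -> W).
Proof.
move=> dfc e0 quad.
have dG : G \o shift p = cst (G p) + df +o_ 0 id.
  apply/eqaddoP => eps eps0; apply: (near_absvP N 0 _).2.
  have epsE : eps = real_emb N (N eps) by rewrite -(absvE N) gtr0_norm.
  have eps0' : 0 < N eps by rewrite -(real_emb_gt0 N) -epsE.
  have C1 : 0 < `|C| + 1 by rewrite ltr_wpDl.
  exists (Num.min e (N eps / (`|C| + 1))).
    by rewrite lt_min e0 divr_gt0.
  move=> d; rewrite subr0 le_min => /andP[de deps].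
  have -> : (G \o shift p - (cst (G p) + df)) d = G (d + p) - G p - df d.
    by rewrite -addrA -opprD.
  rewrite epsE (absv_norm N (id d)) -rmorphM /= absv_norm_le.
  apply: le_trans (quad _ de) _; rewrite expr2 mulrA ler_wpM2r ?absv_ge0 //.
  move: deps; rewrite ler_pdivlMr // mulrC => deps; apply: le_trans deps.
  by rewrite ler_wpM2r ?absv_ge0 // (le_trans (ler_norm C)) // lerDl.
have dE := diff_unique dfc dG.
by split=> //; apply/diff_locallyP; rewrite dE; split.
Qed.

Definition plane_point (x y : K) : 'rV[K]_2 := \row_j if j == ord0 then x else y.

Lemma cx_plane_point x y : cx (plane_point x y) = x.
Proof. by rewrite /cx mxE. Qed.

Lemma cy_plane_point x y : cy (plane_point x y) = y.
Proof. by rewrite /cy mxE. Qed.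

Lemma plane_point_eq (p q : 'rV[K]_2) : cx p = cx q -> cy p = cy q -> p = q.
Proof.
move=> pqx pqy; apply/rowP => j.
case: (unliftP ord0 j) => [j' ->|->]; last exact: pqx.
by rewrite (ord1 j') (_ : lift ord0 ord0 = ord_max) //; exact: val_inj.
Qed.

Lemma absv_plane_le (p : 'rV[K]_2) e : 0 <= e -> N (cx p) <= e -> N (cy p) <= e ->
  N `|p| <= e.
Proof.
move=> e0 px py; apply: absv_mx_le => // i j; rewrite (ord1 i).
case: (unliftP ord0 j) => [j' ->|->]; last exact: px.
by rewrite (ord1 j') (_ : lift ord0 ord0 = ord_max) //; exact: val_inj.
Qed.

Lemma cx_mulmx (v : 'rV[K]_2) (J : 'M[K]_2) :
  cx (v *m J) = cx v * J ord0 ord0 + cy v * J ord_max ord0.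
Proof.
rewrite /cx /cy mxE big_ord_recl big_ord1; congr (_ + v _ _ * J _ _); exact: val_inj.
Qed.

Lemma cy_mulmx (v : 'rV[K]_2) (J : 'M[K]_2) :
  cy (v *m J) = cx v * J ord0 ord_max + cy v * J ord_max ord_max.
Proof.
rewrite /cx /cy mxE big_ord_recl big_ord1; congr (_ + v _ _ * J _ _); exact: val_inj.
Qed.

Definition series_map (a : bool -> dseries) (p : 'rV[K]_2) : 'rV[K]_2 :=
  plane_point (series_val N (a true) (cx p) (cy p)) (series_val N (a false) (cx p) (cy p)).

Lemma series_map_differentiable (a : bool -> dseries) (r M : R) G p : 0 < r ->
  (forall c, wnorm_le N (polydisc_weight r r) (a c) M) -> N `|p| <= r / 2 ->
  (\forall q \near p, G q = series_map a q) ->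
  differentiable G p /\ forall v, 'd G p v =
   plane_point (series_val N (deriv_fst (a true)) (cx p) (cy p) * cx v +
                series_val N (deriv_snd (a true)) (cx p) (cy p) * cy v)
               (series_val N (deriv_fst (a false)) (cx p) (cy p) * cx v +
                series_val N (deriv_snd (a false)) (cx p) (cy p) * cy v).
Proof.
move=> r0 aM pr /(near_absvP N)[e' e'0 GE].
have r2 : 0 < r / 2 by rewrite divr_gt0.
have rE : r / 2 + r / 2 = r by rewrite -splitr.
have px : N (cx p) <= r / 2 := le_trans (absv_entry N p ord0 ord0) pr.
have py : N (cy p) <= r / 2 := le_trans (absv_entry N p ord0 ord_max) pr.
have aM' c : wnorm_le N (polydisc_weight (r / 2 + r / 2) (r / 2 + r / 2)) (a c) M.
  by rewrite rE.
have quad c := series_quadratic (ltW r2) r2 (aM' c) px py.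
have [At [Bt [At_val Bt_val qt]]] := quad true.
have [Af [Bf [Af_val Bf_val qf]]] := quad false.
rewrite (series_valE At_val) (series_valE Bt_val).
rewrite (series_valE Af_val) (series_valE Bf_val).
pose J : 'M[K]_2 := \matrix_(i, j) if j == ord0 then (if i == ord0 then At else Bt)
                                   else (if i == ord0 then Af else Bf).
have JE v : v *m J = plane_point (At * cx v + Bt * cy v) (Af * cx v + Bf * cy v).
  apply: plane_point_eq; rewrite ?cx_mulmx ?cy_mulmx ?cx_plane_point ?cy_plane_point !mxE /=.
    by rewrite [cx v * _]mulrC [cy v * _]mulrC.
  by rewrite [cx v * _]mulrC [cy v * _]mulrC.
suff [dG dE] : differentiable G p /\ forall v, 'd G p v = v *m J.
  by split=> // v; rewrite dE JE.
pose e := Num.min e' (r / 2).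
have e0 : 0 < e by rewrite lt_min e'0 r2.
have [|dG dE] := @quadratic_differentiable _ _ G p (mulmxr J) ((r / 2) ^- 2 * (3 * M))
  e (@mulmxr_continuous _ _ J) e0; last by split=> // v; rewrite dE.
move=> d.
rewrite le_min => /andP[de' dr].
have -> : G p = series_map a p by apply: GE; rewrite subrr normr0 absv0 ltW.
have -> : G (d + p) = series_map a (d + p) by apply: GE; rewrite addrK.
set sigma := N `|d| / (r / 2).
have sigma01 : 0 <= sigma <= 1.
  by rewrite divr_ge0 ?absv_ge0 ?(ltW r2) //= ler_pdivrMr // mul1r.
have sigmaE : sigma * (r / 2) = N `|d| by rewrite divfK // gt_eqF.
have dx : N (cx d) <= sigma * (r / 2) by rewrite sigmaE; exact: absv_entry.
have dy : N (cy d) <= sigma * (r / 2) by rewrite sigmaE; exact: absv_entry.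
have half : r / 2 <= r by rewrite -{2}rE lerDl ltW.
have val c : has_val N (a c) (cx p) (cy p) (series_val N (a c) (cx p) (cy p)).
  exact: series_valP (aM c) (le_trans px half) (le_trans py half).
have vald c : has_val N (a c) (cx p + cx d) (cy p + cy d)
    (series_val N (a c) (cx p + cx d) (cy p + cy d)).
  by apply: series_valP (aM c) _ _; rewrite -rE; apply: le_trans (absvD _ _ _) _;
    rewrite lerD // (le_trans _ dr) // absv_entry.
have -> : (r / 2) ^- 2 * (3 * M) * N `|d| ^+ 2 = sigma ^+ 2 * (3 * M).
  by rewrite [sigma ^+ 2]expr_div_n; move: ((r / 2) ^- 2) => q; ring.
have M0 := wnorm_ge0 (aM true).
have cD : cx (d + p) = cx p + cx d /\ cy (d + p) = cy p + cy d.
  by rewrite /cx /cy !mxE ![d _ _ + _]addrC.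
rewrite /series_map /= JE cD.1 cD.2; apply: absv_plane_le.
- case/andP: sigma01 => s0 _; apply: mulr_ge0; first exact: exprn_ge0.
  exact: mulr_ge0.
- have := qt _ _ _ _ _ sigma01 dx dy (val true) (vald true).
  by rewrite /cx !mxE.
- have := qf _ _ _ _ _ sigma01 dx dy (val false) (vald false).
  by rewrite /cy !mxE.
Qed.

Lemma derive_coord (G : 'rV[K]_2 -> 'rV[K]_2) p v i j : differentiable G p ->
  'D_v (fun q => G q i j) p = ('d G p v) i j.
Proof.
move=> dG; rewrite -deriveE // /derive; apply: cvg_lim => //.
have cvgG : h^-1 *: (G (h *: v + p) - G p) @[h --> 0^'] --> 'D_v G p.
  exact: diff_derivable.
have := cvg_comp _ _ cvgG (@coord_continuous K 1 2 i j ('D_v G p)).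
by apply: cvg_trans; apply: near_eq_cvg; near=> h; rewrite /= !mxE.
Unshelve. all: by end_near. Qed.

End derivatives.

(** * Analytic diffeomorphisms tangent to the identity *)

Section inverse_map.
Context (R : realType) (K : numFieldType) (N : abs_field R K).
Notation dseries := (nat -> nat -> K).
Implicit Types (a b : bool -> dseries).

Lemma has_val_origin (u : dseries) : has_val N u 0 0 (u 0%N 0%N).
Proof.
apply: (tends_near (n0 := 1%N)) (tends_cst N _) => n n0.
rewrite (@eq_square_sum _ _ _ (fun i j =>
  if (i == 0%N) && (j == 0%N) then u 0%N 0%N else 0)).
  by rewrite square_sum_unit n0.
move=> [|i] [|j] _ _ //=; rewrite ?expr0 ?exprS ?mul0r ?mulr0 ?mulr1 //.
Qed.

Lemma series_val_origin (u : dseries) : series_val N u 0 0 = u 0%N 0%N.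
Proof. exact: series_valE (has_val_origin u). Qed.

Lemma cx0 : cx (0 : 'rV[K]_2) = 0. Proof. by rewrite /cx mxE. Qed.
Lemma cy0 : cy (0 : 'rV[K]_2) = 0. Proof. by rewrite /cy mxE. Qed.

Lemma series_map0 a : (forall c, a c 0%N 0%N = 0) -> series_map N a 0 = 0.
Proof.
move=> a0; apply: plane_point_eq; rewrite /series_map ?cx_plane_point ?cy_plane_point;
  by rewrite ?cx0 ?cy0 series_val_origin a0.
Qed.

Lemma near_series_map a (r M : R) (P : 'rV[K]_2 -> Prop) : 0 < r ->
  (forall c, wnorm_le N (polydisc_weight r r) (a c) M) -> (forall c, a c 0%N 0%N = 0) ->
  (\forall p \near (0 : 'rV[K]_2), P p) ->
  \forall p \near (0 : 'rV[K]_2), P (series_map N a p).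
Proof.
move=> r0 aM a0 nearP.
have [| |dG _] := @series_map_differentiable _ _ N a r M (series_map N a) 0 r0 aM.
- by rewrite normr0 absv0 divr_ge0 // ltW.
- by near=> q.
by have /(_ P) := differentiable_continuous dG; rewrite /= series_map0 //; apply.
Unshelve. all: by end_near. Qed.

Lemma has_val_coord c x y : has_val N (coord_series K c) x y (if c then x else y).
Proof.
case: c; last by have := has_val_unit N 0 1 x y; rewrite expr0 expr1 mul1r.
by have := has_val_unit N 1 0 x y; rewrite expr0 expr1 mulr1.
Qed.

Lemma wnorm_coord (r : R) c : 0 <= r ->
  wnorm_le N (polydisc_weight r r) (coord_series K c) r.
Proof.
move=> r0; case: c.
  have := @wnorm_unit _ _ N (polydisc_weight r r) 1 0.
  by rewrite {1 3}/polydisc_weight expr1 expr0 mulr1; apply.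
have := @wnorm_unit _ _ N (polydisc_weight r r) 0 1.
by rewrite {1 3}/polydisc_weight expr1 expr0 mul1r; apply.
Qed.

Definition tangent_to_id a := forall c, vanishes_below 2 (fun i j =>
  a c i j - coord_series K c i j).

Lemma tangent_to_id0 a c : tangent_to_id a -> a c 0%N 0%N = 0.
Proof. by move=> a1; have := a1 c 0%N 0%N isT; case: c; rewrite subr0. Qed.

Lemma right_inverse a (r M : R) : 0 < r ->
  (forall c, wnorm_le N (polydisc_weight r r) (a c) M) -> tangent_to_id a ->
  exists b s, [/\ 0 < s, forall c, wnorm_le N (polydisc_weight s s) (b c) r,
    tangent_to_id b & \forall q \near (0 : 'rV[K]_2), series_map N a (series_map N b q) = q].
Proof.
move=> r0 aM a1; have r0' := ltW r0.
pose h c : dseries := fun i j => a c i j - coord_series K c i j.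
have [w0 _ _] := polydisc_submultiplicative r0' r0'.
have hM c : wnorm_le N (polydisc_weight r r) (h c) (M + r).
  exact: wnormD w0 (aM c) (wnormN (wnorm_coord c r0')).
have [b [s [s0 bE bM b1]]] := inverse_solution r0 hM a1.
exists b, s; split; [exact: s0|exact: bM|exact: b1|].
apply/(near_absvP N); exists s => // q; rewrite subr0 => qs; have s0' := ltW s0.
have qx : N (cx q) <= s := le_trans (absv_entry N q ord0 ord0) qs.
have qy : N (cy q) <= s := le_trans (absv_entry N q ord0 ord_max) qs.
pose v c := series_val N (b c) (cx q) (cy q).
have bv c : has_val N (b c) (cx q) (cy q) (v c) by exact: series_valP (bM c) qx qy.
have vr c : N (v c) <= r := has_val_le qx qy (bM c) (bv c).
pose w c := series_val N (h c) (v true) (v false).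
have hw c : has_val N (h c) (v true) (v false) (w c).
  exact: series_valP (hM c) (vr true) (vr false).
have b0 c : b c 0%N 0%N = 0 by exact: tangent_to_id0.
have vE c : v c = (if c then cx q else cy q) - w c.
  have comp := has_val_comp s0' s0' qx qy (b0 true) (b0 false) (bM true) (bM false)
    (hM c) (bv true) (bv false) (hw c).
  apply: has_val_unique (bv c) _.
  apply: (tends_near (n0 := 0%N)) (has_valD (has_val_coord c _ _) (has_valN comp)) => n _.
  by apply: eq_square_sum => i j _ _; rewrite -bE.
have aE c : series_val N (a c) (v true) (v false) = if c then cx q else cy q.
  apply: series_valE.
  have -> : (if c then cx q else cy q) = (if c then v true else v false) + w c.
    by rewrite -[LHS](subrK (w c)) -vE; case: c.
  apply: (tends_near (n0 := 0%N)) (has_valD (has_val_coord c _ _) (hw c)) => n _.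
  by apply: eq_square_sum => i j _ _; rewrite /h addrC subrK.
by apply: plane_point_eq; rewrite /series_map !(cx_plane_point, cy_plane_point) (aE true, aE false).
Qed.

(** A right inverse [b] of [a] has itself a right inverse [a'], and then
    [a = a (b a') = (a b) a' = a'] near the origin. *)
Lemma two_sided_inverse a (r M : R) : 0 < r ->
  (forall c, wnorm_le N (polydisc_weight r r) (a c) M) -> tangent_to_id a ->
  exists b s, [/\ 0 < s, forall c, wnorm_le N (polydisc_weight s s) (b c) r,
    tangent_to_id b,
    \forall q \near (0 : 'rV[K]_2), series_map N a (series_map N b q) = q &
    \forall q \near (0 : 'rV[K]_2), series_map N b (series_map N a q) = q].
Proof.
move=> r0 aM a1.
have [b [s [s0 bM b1 ab]]] := right_inverse r0 aM a1.
have [a' [t [t0 a'M a'1 ba']]] := right_inverse s0 bM b1.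
exists b, s; split=> //.
have aba' := near_series_map t0 a'M (fun c => tangent_to_id0 c a'1) ab.
near=> q.
have ba'q : series_map N b (series_map N a' q) = q by near: q.
suff -> : series_map N a q = series_map N a' q by [].
by rewrite -{1}ba'q; near: q.
Unshelve. all: by end_near. Qed.

Lemma analytic_series_map a (r M : R) : 0 < r ->
  (forall c, wnorm_le N (polydisc_weight r r) (a c) M) ->
  analytic_map_germ (series_map N a).
Proof.
move=> r0 aM; split.
  apply: (analytic_series_val r0 (aM true)); near=> p.
  by rewrite /= /series_map cx_plane_point.
apply: (analytic_series_val r0 (aM false)); near=> p.
by rewrite /= /series_map cy_plane_point.
Unshelve. all: by end_near. Qed.

End inverse_map.

(** * The normal form for a prepared linear part *)

Section core.
Context (R : realType) (K : numFieldType) (N : abs_field R K).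
Notation dseries := (nat -> nat -> K).
Implicit Types (a : dseries) (z : bool -> dseries).

Lemma cauchy_prod_snd_series a i j :
  cauchy_prod (snd_series K) a i j = if j is j'.+1 then a i j' else 0.
Proof.
rewrite /cauchy_prod big_ord_recl [X in _ + X]big1 ?addr0; last first.
  by move=> k _; rewrite big1 // => l _; rewrite /snd_series /= mul0r.
case: j => [|j]; first by rewrite big_ord1 /snd_series /= mul0r.
rewrite big_ord_recl {1}/snd_series /= mul0r add0r big_ord_recl.
rewrite big1 ?addr0; last by move=> l _; rewrite /snd_series /= mul0r.
by rewrite /snd_series /= mul1r subn0 subn1.
Qed.

Lemma axis_shift_series a i j :
  axis_series a i j + cauchy_prod (snd_series K) (shift_series a) i j = a i j.
Proof. by rewrite cauchy_prod_snd_series; case: j => [|j] /=; rewrite ?addr0 ?add0r. Qed.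

Lemma has_val_axis a x y y' s :
  has_val N (axis_series a) x y s -> has_val N (axis_series a) x y' s.
Proof.
apply: (tends_near (n0 := 0%N)) => n _; apply: eq_square_sum => i [|j] _ _ /=.
  by rewrite !expr0.
by rewrite !mul0r.
Qed.

Lemma deriv_fst_chart z c i j : deriv_fst (chart z c) i j =
  (if c then one_series K i j else 0) + shift_series (z c) i j.
Proof.
rewrite /deriv_fst /chart /shift_series mulrDr /= mulVKf ?pnatr_eq0 //.
congr (_ + _); case: c; rewrite /fst_series /snd_series /one_series /=; last by rewrite mulr0.
by rewrite eqSS; case: i => [|i]; rewrite ?mul1r ?mulr0.
Qed.

Lemma deriv_snd_chart z c i j : deriv_snd (chart z c) i j =
  (if c then 0 else one_series K i j) + deriv_snd (int_shift (z c)) i j.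
Proof.
rewrite /deriv_snd /chart mulrDr; congr (_ + _).
case: c; rewrite /fst_series /snd_series /one_series /=; first by rewrite andbF mulr0.
by rewrite eqSS; case: j => [|j]; rewrite ?mul1r // andbF mulr0.
Qed.

Lemma chart_tangent_to_id z : flat z -> tangent_to_id (chart z).
Proof.
move=> flatz c i j ij2; rewrite /chart /coord_series.
have -> : (if c then fst_series K i j else snd_series K i j) =
  (if c then fst_series K else snd_series K) i j by case: c.
rewrite [_ + int_shift _ _ _]addrC addrK; case: i ij2 => [|[|i]] //; case: j => [|j] // _.
by rewrite /= (flatz c).2 mulr0.
Qed.

(** The equation satisfied by [z] says that the field
    [(y + f(x)) d/dx + g(x) d/dy] is mapped by the chart onto the field [X]. *)
Lemma normalizing_data_pde (h : bool -> dseries) z rho r M C q : 0 < r ->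
  (forall c, wnorm_le N (polydisc_weight r r) (h c) C) ->
  (forall c i j, normalizing_step h z c i j = z c i j) ->
  normalizing_data N z rho r M -> N `|q : 'rV[K]_2| <= rho ->
  let x := cx q in let y := cy q in
  let f := series_val N (axis_series (z true)) x 0 in
  let g := series_val N (axis_series (z false)) x 0 in
  let xi := series_val N (chart z true) x y in
  let eta := series_val N (chart z false) x y in
  series_val N (deriv_fst (chart z true)) x y * (y + f) +
  series_val N (deriv_snd (chart z true)) x y * g =
    eta + series_val N (h true) xi eta /\
  series_val N (deriv_fst (chart z false)) x y * (y + f) +
  series_val N (deriv_snd (chart z false)) x y * g =
    series_val N (h false) xi eta.
Proof.
move=> r0 hC zE [rho0 chartr zM SM DM] qrho x y f g xi eta.
have xr : N x <= rho := le_trans (absv_entry N q ord0 ord0) qrho.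
have yr : N y <= rho := le_trans (absv_entry N q ord0 ord_max) qrho.
have rho0' := ltW rho0; have [w0 _ _] := polydisc_submultiplicative rho0' rho0'.
pose val u := series_val N u x y.
have axisM c := wnorm_axis w0 (zM c).
have zv c : has_val N (z c) x y (val (z c)) by exact: series_valP (zM c) xr yr.
have Sv c : has_val N (shift_series (z c)) x y (val (shift_series (z c))).
  exact: series_valP (SM c) xr yr.
have Dv c : has_val N (deriv_snd (int_shift (z c))) x y
    (val (deriv_snd (int_shift (z c)))).
  exact: series_valP (DM c) xr yr.
have chv c : has_val N (chart z c) x y (val (chart z c)).
  exact: series_valP (chartr c) xr yr.
have x00 : N 0 <= rho by rewrite absv0.
have fv : has_val N (axis_series (z true)) x y f.
  exact: has_val_axis (series_valP (axisM true) xr x00).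
have gv : has_val N (axis_series (z false)) x y g.
  exact: has_val_axis (series_valP (axisM false) xr x00).
have chr c : N (val (chart z c)) <= r := has_val_le xr yr (chartr c) (chv c).
have hv c : has_val N (h c) xi eta (series_val N (h c) xi eta).
  exact: series_valP (hC c) (chr true) (chr false).
have Hv c : has_val N (comp_series (h c) (chart z true) (chart z false)) x y
    (series_val N (h c) xi eta).
  exact: (has_val_comp rho0' rho0' xr yr (chart00 _ _) (chart00 _ _) (chartr true)
    (chartr false) (hC c) (chv true) (chv false) (hv c)).
have ysnd : has_val N (snd_series K) x y y by exact: (has_val_coord N false).
have Zv c t : has_val N (axis_series (z c)) x y t ->
    val (z c) = t + y * val (shift_series (z c)).
  move=> tv; apply: has_val_unique (zv c) _.
  have prod := has_val_cauchy_prod xr yr (wnorm_coord N false rho0') (SM c) ysnd (Sv c).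
  apply: (tends_near (n0 := 0%N)) (has_valD tv prod) => n _.
  by apply: eq_square_sum => i j _ _; rewrite axis_shift_series.
have Iv : has_val N (int_shift (z false)) x y (eta - y).
  apply: (tends_near (n0 := 0%N)) (has_valD (chv false) (has_valN ysnd)) => n _.
  by apply: eq_square_sum => i j _ _; rewrite /chart addrAC subrr add0r.
have zeq c : val (z c) = (if c then eta - y else 0) + series_val N (h c) xi eta -
    (g * val (deriv_snd (int_shift (z c))) + f * val (shift_series (z c))).
  apply: has_val_unique (zv c) _.
  have p1 := has_val_cauchy_prod xr yr (axisM false) (DM c) gv (Dv c).
  have p2 := has_val_cauchy_prod xr yr (axisM true) (SM c) fv (Sv c).
  have lin : has_val N (fun i j => if c then int_shift (z false) i j else 0) x y
      (if c then eta - y else 0).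
    case: (c); first exact: Iv.
    apply: (tends_near (n0 := 0%N)) (tends_cst N 0) => n _.
    rewrite -[LHS](square_sum0 K n); apply: eq_square_sum => i j _ _.
    by rewrite mul0r.
  apply: (tends_near (n0 := 0%N))
    (has_valD (has_valD lin (Hv c)) (has_valN (has_valD p1 p2))) => n _.
  by apply: eq_square_sum => i j _ _; rewrite -[z c i j]zE.
have onev : has_val N (one_series K) x y 1.
  by have := has_val_unit N 0 0 x y; rewrite !expr0 mulr1.
have dfst c : val (deriv_fst (chart z c)) = (if c then 1 else 0) + val (shift_series (z c)).
  apply: series_valE; case: c.
    apply: (tends_near (n0 := 0%N)) (has_valD onev (Sv true)) => n _.
    by apply: eq_square_sum => i j _ _; rewrite deriv_fst_chart.
  rewrite add0r; apply: (tends_near (n0 := 0%N)) (Sv false) => n _.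
  by apply: eq_square_sum => i j _ _; rewrite deriv_fst_chart add0r.
have dsnd c : val (deriv_snd (chart z c)) =
    (if c then 0 else 1) + val (deriv_snd (int_shift (z c))).
  apply: series_valE; case: c.
    rewrite add0r; apply: (tends_near (n0 := 0%N)) (Dv true) => n _.
    by apply: eq_square_sum => i j _ _; rewrite deriv_snd_chart add0r.
  apply: (tends_near (n0 := 0%N)) (has_valD onev (Dv false)) => n _.
  by apply: eq_square_sum => i j _ _; rewrite deriv_snd_chart.
have := zeq true; have := zeq false; rewrite (Zv true f fv) (Zv false g gv).
rewrite -/(val _) -/(val (deriv_snd (chart z true))) -/(val (deriv_fst (chart z false))).
rewrite -/(val (deriv_snd (chart z false))) !dfst !dsnd.
set ht := series_val N (h true) xi eta; set hf := series_val N (h false) xi eta.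
move: (val (shift_series (z true))) (val (shift_series (z false))) => St Sf.
move: (val (deriv_snd (int_shift (z true)))) (val (deriv_snd (int_shift (z false)))).
move=> Dt Df eqf eqt; split.
  have -> : (1 + St) * (y + f) + (0 + Dt) * g =
    (f + y * St) + y + (g * Dt + f * St) by ring.
  by rewrite eqt; ring.
have -> : (0 + Sf) * (y + f) + (1 + Df) * g = (g + y * Sf) + (g * Df + f * Sf) by ring.
by rewrite eqf; ring.
Qed.

Lemma analytic_axis z r M c : 0 < r ->
  (forall c, wnorm_le N (polydisc_weight r r) (z c) M) -> flat z ->
  let f x := series_val N (axis_series (z c)) x 0 in
  analytic_germ1 f /\ f 0 = 0.
Proof.
move=> r0 zM flatz f; split; last by rewrite /f series_val_origin /= (flatz c).1.
have r0' := ltW r0; have [w0 _ _] := polydisc_submultiplicative r0' r0'.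
exists (fun n => z c n 0%N); apply/(near_absvP N); exists r => // x; rewrite subr0.
have -> : N `|x| = N x by apply: (real_emb_inj (N := N)); rewrite -!(absvE N) normr_id.
move=> xr; have x00 : N 0 <= r by rewrite absv0.
have fx := series_valP (wnorm_axis w0 (zM c)) xr x00.
apply/cvgrPdist_le => eps eps0.
have epsE : eps = real_emb N (N eps) by rewrite -(absvE N) gtr0_norm.
have eps0' : 0 < N eps by rewrite -(real_emb_gt0 N) -epsE.
have [n0 fn0] := fx _ eps0'; exists n0.+1 => // -[|n] //= n0n.
rewrite epsE (absvE N) real_emb_le absv_distC.
have := fn0 n.+1 (ltnW n0n).
suff -> : square_sum n.+1 (fun i j => axis_series (z c) i j * (x ^+ i * 0 ^+ j)) =
  series (fun n => z c n 0%N * x ^+ n) n.+1 by [].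
rewrite /series /= big_mkord; apply: eq_bigr => i _.
rewrite big_ord_recl /= expr0 mulr1 big1 ?addr0 // => j _.
by rewrite mul0r.
Qed.

(** Let [Y] be the normal form at [q] and [p = Gamma q]. The equation reads
    [DGamma_q Y = X p]; since [Phi Gamma = id], applying [DPhi_p] gives
    [DPhi_p (X p) = Y], which are the components of [X] in the chart [Phi]. *)
Lemma prepared_normal_form (X : 'rV[K]_2 -> 'rV[K]_2) (h : bool -> dseries) r C : 0 < r ->
  (forall c, wnorm_le N (polydisc_weight r r) (h c) C) ->
  (forall c, h c 0%N 0%N = 0) -> (forall c, h c 0%N 1%N = 0) ->
  (\forall p \near (0 : 'rV[K]_2), X p =
     plane_point (cy p + series_val N (h true) (cx p) (cy p))
                 (series_val N (h false) (cx p) (cy p))) ->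
  has_normal_form X.
Proof.
move=> r0 hC h00 h01 XE.
have [z [rho [M [flatz zE zdata]]]] := normalizing_solution r0 hC h00 h01.
have [rho0 chartr zM _ _] := zdata.
have chart1 := chart_tangent_to_id flatz.
have [b [s [s0 bM b1 chart_b b_chart]]] := two_sided_inverse rho0 chartr chart1.
have chart_0 c : chart z c 0%N 0%N = 0 by exact: chart00.
have b_0 c : b c 0%N 0%N = 0 by exact: tangent_to_id0.
pose Gamma := series_map N (chart z); pose Phi := series_map N b.
pose f x := series_val N (axis_series (z true)) x 0.
pose g x := series_val N (axis_series (z false)) x 0.
exists Phi, f, g; split.
- split; [exact: series_map0|exact: analytic_series_map s0 bM|exists Gamma; split].
  + exact: series_map0.
  + exact: analytic_series_map rho0 chartr.
  + exact: chart_b.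
  + exact: b_chart.
- exact: analytic_axis true rho0 zM flatz.
- exact: analytic_axis false rho0 zM flatz.
rewrite /vf_in_coordinates /=.
have near_small e : 0 < e -> \forall p \near (0 : 'rV[K]_2), N `|p| <= e.
  by move=> e0; apply/(near_absvP N); exists e => // p; rewrite subr0.
have rho2 : 0 < rho / 2 by rewrite divr_gt0.
have s2 : 0 < s / 2 by rewrite divr_gt0.
have XE_Gamma := near_series_map rho0 chartr chart_0 XE.
have b_chart_near : \forall q \near (0 : 'rV[K]_2), \forall q' \near q, Phi (Gamma q') = q'.
  by apply/near_join; exact: b_chart.
have pullback (P : 'rV[K]_2 -> Prop) : (\forall q \near (0 : 'rV[K]_2), P q) ->
    \forall p \near (0 : 'rV[K]_2), P (Phi p).
  exact: near_series_map s0 bM b_0.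
have Phi_small := pullback _ (near_small _ rho2).
have Phi_XE := pullback _ XE_Gamma.
have Phi_b_chart := pullback _ b_chart_near.
have p_small := near_small _ s2.
near=> p.
have Gq : Gamma (Phi p) = p by near: p; exact: chart_b.
have q_small : N `|Phi p| <= rho / 2 by near: p; exact: Phi_small.
have Xq : X (Gamma (Phi p)) = plane_point
    (cy (Gamma (Phi p)) + series_val N (h true) (cx (Gamma (Phi p))) (cy (Gamma (Phi p))))
    (series_val N (h false) (cx (Gamma (Phi p))) (cy (Gamma (Phi p)))).
  by near: p; exact: Phi_XE.
have PhiG : \forall q' \near Phi p, (Phi \o Gamma) q' = id q'.
  by near: p; exact: Phi_b_chart.
have p_s : N `|p| <= s / 2 by near: p; exact: p_small.
move: (Phi p) Gq q_small Xq PhiG => q Gq q_small Xq PhiG.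
have [|dPhi _] := series_map_differentiable (G := Phi) s0 bM p_s.
  by near=> p'.
have [|dGamma dGammaE] := series_map_differentiable (G := Gamma) rho0 chartr q_small.
  by near=> p'.
pose Y := plane_point (cy q + f (cx q)) (g (cx q)).
have dGY : 'd Gamma q Y = X p.
  have q_rho : N `|q| <= rho by rewrite (le_trans q_small) // ler_pdivrMr // ler_pMr // ler1n.
  have [eq1 eq2] := normalizing_data_pde r0 hC zE zdata q_rho.
  rewrite -Gq Xq dGammaE /Y cx_plane_point cy_plane_point.
  rewrite /Gamma /series_map !cx_plane_point !cy_plane_point.
  by congr plane_point.
have dPhi' : differentiable Phi (Gamma q) by rewrite Gq.
have dPhiX : 'd Phi p (X p) = Y.
  have dcomp := congr1 (fun F => F Y) (diff_comp dGamma dPhi').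
  rewrite -dGY -[in LHS]Gq -[LHS]/(('d Phi (Gamma q) \o 'd Gamma q) Y) -dcomp.
  rewrite -deriveE; last exact: differentiable_comp.
  by rewrite (near_eq_derive Y PhiG) derive_id.
rewrite !derive_coord // dPhiX.
split; [exact: cx_plane_point | exact: cy_plane_point].
Unshelve. all: by end_near. Qed.

End core.

(** * Linear changes of coordinates *)

Section linear_change.
Context (R : realType) (K : numFieldType) (N : abs_field R K).
Notation dseries := (nat -> nat -> K).

(** Both components of a map are to be expanded with the same radius and bound. *)
Lemma common_expansion (h1 h2 : 'rV[K]_2 -> K) :
  analytic_germ2 h1 -> analytic_germ2 h2 -> exists (a : bool -> dseries) r M, [/\ 0 < r,
    forall c, wnorm_le N (polydisc_weight r r) (a c) M &
    forall p, N `|p| <= r ->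
      forall c, has_val N (a c) (cx p) (cy p) (if c then h1 p else h2 p)].
Proof.
move=> /(analytic_germ2P N)[a1 [r1 [M1 [r1_gt0 aM1 ah1]]]].
move=> /(analytic_germ2P N)[a2 [r2 [M2 [r2_gt0 aM2 ah2]]]].
pose r := Num.min r1 r2; have r0 : 0 < r by rewrite lt_min r1_gt0.
have rr1 : r <= r1 by rewrite ge_min lexx.
have rr2 : r <= r2 by rewrite ge_min lexx orbT.
have lew t : r <= t -> forall i j, polydisc_weight r r i j <= polydisc_weight t t i j.
  move=> rt i j; have t0 : 0 <= t := le_trans (ltW r0) rt.
  by rewrite ler_pM ?exprn_ge0 ?lerXn2r ?nnegrE ?(ltW r0).
exists (fun c => if c then a1 else a2), r, (Num.max M1 M2); split=> //.
  case; [apply: wnorm_leW (wnorm_weight (lew _ rr1) aM1)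
        |apply: wnorm_leW (wnorm_weight (lew _ rr2) aM2)].
    by rewrite le_max lexx.
  by rewrite le_max lexx orbT.
move=> p pr.
have px : N (cx p) <= r := le_trans (absv_entry N p ord0 ord0) pr.
have py : N (cy p) <= r := le_trans (absv_entry N p ord0 ord_max) pr.
by case; [apply: ah1; apply: le_trans rr1|apply: ah2; apply: le_trans rr2].
Qed.

Lemma analytic_map_expansion F : analytic_map_germ F -> exists a r M, [/\ 0 < r,
  forall c, wnorm_le N (polydisc_weight r r) (a c) M &
  \forall p \near (0 : 'rV[K]_2), F p = series_map N a p].
Proof.
move=> [Fx Fy]; have [a [r [M [r0 aM aF]]]] := common_expansion Fx Fy.
exists a, r, M; split=> //; apply/(near_absvP N); exists r => // p; rewrite subr0 => pr.
apply: plane_point_eq; rewrite /series_map ?cx_plane_point ?cy_plane_point; symmetry;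
  apply: series_valE; [exact: aF pr true|exact: aF pr false].
Qed.

Lemma analytic_germ2_comb (h1 h2 : 'rV[K]_2 -> K) c1 c2 :
  analytic_germ2 h1 -> analytic_germ2 h2 ->
  analytic_germ2 (fun p => h1 p * c1 + h2 p * c2).
Proof.
move=> h1a h2a; have [a [r [M [r0 aM ah]]]] := common_expansion h1a h2a.
have [w0 _ _] := polydisc_submultiplicative (ltW r0) (ltW r0).
apply: (analytic_series_val r0 (wnormD w0 (wnormZ c1 (aM true)) (wnormZ c2 (aM false)))).
apply/(near_absvP N); exists r => // p; rewrite subr0 => pr; symmetry; apply: series_valE.
rewrite [h1 p * c1]mulrC [h2 p * c2]mulrC.
exact: has_valD (has_valZ c1 (ah p pr true)) (has_valZ c2 (ah p pr false)).
Qed.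

Lemma near_mulmx (J : 'M[K]_2) (P : 'rV[K]_2 -> Prop) :
  (\forall p \near (0 : 'rV[K]_2), P p) ->
  \forall p \near (0 : 'rV[K]_2), P (p *m J).
Proof.
move=> nearP; have := @mulmxr_continuous _ _ N _ _ J 0 P.
by rewrite /= mul0mx; apply.
Qed.

Lemma analytic_germ2_mulmx (h : 'rV[K]_2 -> K) (J : 'M[K]_2) :
  analytic_germ2 h -> analytic_germ2 (fun p => h (p *m J)).
Proof.
move=> /(analytic_germ2P N)[a [r [M [r0 aM ah]]]].
pose l c : dseries := fun i j =>
  J ord0 (if c then ord0 else ord_max) * fst_series K i j +
  J ord_max (if c then ord0 else ord_max) * snd_series K i j.
pose S := \sum_i \sum_j N (J i j).
have NJ i j : N (J i j) <= S.
  rewrite /S (bigD1 i) //= (bigD1 j) //= -addrA lerDl addr_ge0 // sumr_ge0 // => k _.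
    exact: absv_ge0.
  by rewrite sumr_ge0 // => k' _; exact: absv_ge0.
have S0 : 0 <= S := le_trans (absv_ge0 N _) (NJ ord0 ord0).
have S1 : 0 < 2 * S + 1 by rewrite ltr_wpDl // mulr_ge0.
pose s := r / (2 * S + 1); have s0 : 0 < s by rewrite divr_gt0.
have sE : s * (2 * S + 1) = r by rewrite divfK // gt_eqF.
have s0' := ltW s0.
have wM := polydisc_submultiplicative s0' s0'; have [w0 _ _] := wM.
have lr c : wnorm_le N (polydisc_weight s s) (l c) r.
  have b1 := wnormZ (J ord0 (if c then ord0 else ord_max)) (wnorm_coord N true s0').
  have b2 := wnormZ (J ord_max (if c then ord0 else ord_max)) (wnorm_coord N false s0').
  apply: wnorm_leW (wnormD w0 b1 b2); rewrite -sE -mulrDl mulrC ler_wpM2l //.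
  apply: (@le_trans _ _ (S + S)); first by rewrite lerD ?NJ.
  by rewrite -mulr2n -[S *+ 2]mulr_natl lerDl.
have l0 c : l c 0%N 0%N = 0 by rewrite /l /fst_series /snd_series /= !mulr0 addr0.
apply: (analytic_series_val s0 (wnorm_comp wM (lr true) (lr false) aM)).
apply/(near_absvP N); exists s => // p; rewrite subr0 => ps; symmetry.
have px : N (cx p) <= s := le_trans (absv_entry N p ord0 ord0) ps.
have py : N (cy p) <= s := le_trans (absv_entry N p ord0 ord_max) ps.
have lv c : has_val N (l c) (cx p) (cy p) (if c then cx (p *m J) else cy (p *m J)).
  have := has_valD
    (has_valZ (J ord0 (if c then ord0 else ord_max)) (has_val_coord N true (cx p) (cy p)))
    (has_valZ (J ord_max (if c then ord0 else ord_max)) (has_val_coord N false (cx p) (cy p))).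
  by rewrite [_ * cx p]mulrC [_ * cy p]mulrC; case: c; rewrite ?cx_mulmx ?cy_mulmx.
apply: series_valE.
apply: (has_val_comp s0' s0' px py (l0 true) (l0 false) (lr true) (lr false) aM
  (lv true) (lv false)).
by apply: ah; [exact: has_val_le px py (lr true) (lv true)
              |exact: has_val_le px py (lr false) (lv false)].
Qed.

Lemma analytic_map_mulmx (F : 'rV[K]_2 -> 'rV[K]_2) (J : 'M[K]_2) :
  analytic_map_germ F -> analytic_map_germ (fun p => F p *m J).
Proof.
move=> [Fx Fy]; split.
  have := analytic_germ2_comb (J ord0 ord0) (J ord_max ord0) Fx Fy.
  by congr analytic_germ2; apply/funext => p; rewrite /= cx_mulmx.
have := analytic_germ2_comb (J ord0 ord_max) (J ord_max ord_max) Fx Fy.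
by congr analytic_germ2; apply/funext => p; rewrite /= cy_mulmx.
Qed.

Lemma analytic_mulmx_map (F : 'rV[K]_2 -> 'rV[K]_2) (J : 'M[K]_2) :
  analytic_map_germ F -> analytic_map_germ (fun p => F (p *m J)).
Proof. by move=> [Fx Fy]; split; [exact: (analytic_germ2_mulmx J Fx)|exact: (analytic_germ2_mulmx J Fy)]. Qed.

Lemma diff_quotient_mulmx (W : normedModType K) (h : 'rV[K]_2 -> W) (J : 'M[K]_2) p v :
  (fun t => t^-1 *: (h ((t *: v + p) *m J) - h (p *m J))) =
  (fun t => t^-1 *: (h (t *: (v *m J) + p *m J) - h (p *m J))).
Proof. by apply/funext => t; rewrite mulmxDl scalemxAl. Qed.

Lemma derive_mulmx_arg (W : normedModType K) (h : 'rV[K]_2 -> W) (J : 'M[K]_2) p v :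
  'D_v (fun q => h (q *m J)) p = 'D_(v *m J) h (p *m J).
Proof.
by rewrite /derive /= diff_quotient_mulmx.
Qed.

Lemma derivable_mulmx_arg (W : normedModType K) (h : 'rV[K]_2 -> W) (J : 'M[K]_2) p v :
  derivable h (p *m J) (v *m J) -> derivable (fun q => h (q *m J)) p v.
Proof.
by rewrite /derivable /= diff_quotient_mulmx.
Qed.

Lemma derive_mulmx (F : 'rV[K]_2 -> 'rV[K]_2) (J : 'M[K]_2) p v :
  derivable F p v -> 'D_v (fun q => F q *m J) p = 'D_v F p *m J.
Proof.
move=> dF; rewrite /derive; apply: cvg_lim => //.
have := cvg_comp _ _ dF (@mulmxr_continuous _ _ N _ _ J ('D_v F p)).
apply: cvg_trans; apply: near_eq_cvg; near=> t.
by rewrite /= -mulmxBl scalemxAl.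
Unshelve. all: by end_near. Qed.

Lemma normal_form_conjugate (X : 'rV[K]_2 -> 'rV[K]_2) (L : 'M[K]_2) : L \in unitmx ->
  has_normal_form (fun p => X (p *m L) *m invmx L) -> has_normal_form X.
Proof.
move=> Lu [Phi [f [g [[Phi0 Phia [Psi [Psi0 Psia PsiPhi PhiPsi]]] fa ga vf]]]].
exists (fun p => Phi (p *m invmx L)), f, g; split=> //.
  split; [by rewrite mul0mx|exact: (analytic_mulmx_map (invmx L) Phia)|].
  exists (fun q => Psi q *m L); split.
  - by rewrite Psi0 mul0mx.
  - exact: (analytic_map_mulmx L Psia).
  - have := near_mulmx (invmx L) PsiPhi; apply: filterS => p ->.
    exact: mulmxKV.
  - by apply: filterS PhiPsi => q; rewrite mulmxK.
have := near_mulmx (invmx L) vf; apply: filterS => p /=.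
rewrite (mulmxKV Lu).
move=> [vfx vfy].
split; [rewrite -vfx -(derive_mulmx_arg (@cx K \o Phi)) //|
        rewrite -vfy -(derive_mulmx_arg (@cy K \o Phi)) //].
Qed.

(** If no vector is sent by [J] to a vector independent from it, then the
    basis vectors and their sum are eigenvectors and [J] is scalar. *)
Lemma nonscalar_cyclic_vector (J : 'M[K]_2) : (forall l, J <> l%:M) ->
  exists L : 'M[K]_2, L \in unitmx /\ plane_point 1 0 *m L = plane_point 0 1 *m L *m J.
Proof.
move=> nonscalar.
pose a := J ord0 ord0; pose b := J ord0 ord_max.
pose c := J ord_max ord0; pose d := J ord_max ord_max.
pose L (u v : K) : 'M[K]_2 := \matrix_(i, j)
  if i == ord0 then (if j == ord0 then u * a + v * c else u * b + v * d)
  else (if j == ord0 then u else v).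
have LE u v : plane_point 1 0 *m L u v = plane_point 0 1 *m L u v *m J.
  by apply: plane_point_eq; rewrite ?cx_mulmx ?cy_mulmx ?cx_mulmx ?cy_mulmx
    ?cx_plane_point ?cy_plane_point !mxE /= /a /b /c /d; ring.
have Ldet u v : \det (L u v) = (u * a + v * c) * v - (u * b + v * d) * u.
  rewrite (expand_det_row _ ord_max) big_ord_recl big_ord1 /cofactor !det_mx11 !mxE /=.
  by rewrite /bump /= !(add0n, addn0) expr1 -signr_odd /= expr0; ring.
have witness u v : \det (L u v) != 0 -> exists L : 'M[K]_2,
    L \in unitmx /\ plane_point 1 0 *m L = plane_point 0 1 *m L *m J.
  by move=> L0; exists (L u v); rewrite unitmxE unitfE.
have [b0|b0] := eqVneq b 0; last first.
  by apply: (witness 1 0); rewrite Ldet !mul0r !addr0 !mul1r mulr0 mulr1 sub0r oppr_eq0.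
have [c0|c0] := eqVneq c 0; last first.
  by apply: (witness 0 1); rewrite Ldet !mul0r !add0r !mul1r mulr0 mulr1 subr0.
have [ad|ad] := eqVneq a d; last first.
  by apply: (witness 1 1); rewrite Ldet b0 c0 !mul1r addr0 add0r !mulr1 subr_eq0.
case: (nonscalar a); apply/matrixP => i j; rewrite !mxE.
have ordE (k : 'I_2) : k = ord0 \/ k = ord_max.
  case: (unliftP ord0 k) => [k' ->|->]; [right|by left].
  by rewrite (ord1 k'); exact: val_inj.
by case: (ordE i) => ->; case: (ordE j) => ->; rewrite ?mulr1n ?mulr0n.
Qed.

(** With [e] a cyclic vector of the linear part [A], the rows [A e] and [e] of [L] are
    the new basis. In these coordinates [A] maps [(0, 1)] to [(1, 0)], that is, the
    coefficients of [y] in the two components are 1 and 0. *)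
Lemma normal_form (X : 'rV[K]_2 -> 'rV[K]_2) :
  analytic_map_germ X -> X 0 = 0 -> ~ radial_linear_part X -> has_normal_form X.
Proof.
move=> Xa X0 nonrad.
have [L [Lu LJ]] : exists L : 'M[K]_2,
    L \in unitmx /\ plane_point 1 0 *m L = plane_point 0 1 *m L *m 'J X 0.
  by apply: nonscalar_cyclic_vector => l JE; apply: nonrad; exists l.
apply: (normal_form_conjugate Lu).
set Y := fun p => X (p *m L) *m invmx L.
have Ya : analytic_map_germ Y by exact: analytic_map_mulmx (analytic_mulmx_map _ Xa).
have Y0 : Y 0 = 0 by rewrite /Y mul0mx X0 mul0mx.
have small0 (r : R) : 0 < r -> N `|0 : 'rV[K]_2| <= r / 2.
  by move=> r0; rewrite normr0 absv0 divr_ge0 // ltW.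
have dX : differentiable X 0.
  have [a [r [M [r0 aM XE]]]] := analytic_map_expansion Xa.
  by have [] := series_map_differentiable r0 aM (small0 r r0) XE.
have [a [r [M [r0 aM YE]]]] := analytic_map_expansion Ya.
have [dY dYE] := series_map_differentiable r0 aM (small0 r r0) YE.
have dYe : 'd Y 0 (plane_point 0 1) = plane_point 1 0.
  have dXL : 'D_(plane_point 0 1) (fun p => X (p *m L)) 0 = 'D_(plane_point 0 1 *m L) X 0.
    by rewrite derive_mulmx_arg mul0mx.
  rewrite -deriveE // derive_mulmx ?dXL ?deriveEjacobian //.
    by rewrite -LJ mulmxK.
  by apply: derivable_mulmx_arg; rewrite mul0mx; exact: diff_derivable.
have a00 c : a c 0%N 0%N = 0.
  have := nbhs_singleton YE; rewrite Y0 /series_map cx0 cy0 !series_val_origin => a0.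
  case: c; [have := congr1 (@cx K) a0|have := congr1 (@cy K) a0].
    by rewrite cx0 cx_plane_point.
  by rewrite cy0 cy_plane_point.
have a01 c : a c 0%N 1%N = if c then 1 else 0.
  move: (dYE (plane_point 0 1)); rewrite dYe cx0 cy0 !series_val_origin.
  rewrite cx_plane_point cy_plane_point !mulr0 !mulr1 !add0r /deriv_snd !mul1r => a1.
  case: c; [have := congr1 (@cx K) a1|have := congr1 (@cy K) a1].
    by rewrite !cx_plane_point.
  by rewrite !cy_plane_point.
have r0' := ltW r0; have [w0 _ _] := polydisc_submultiplicative r0' r0'.
(* The first component is y + h true. *)
pose h c : dseries := fun i j => a c i j + (if c then -1 else 0) * snd_series K i j.
have hM c : wnorm_le N (polydisc_weight r r) (h c) (M + N (if c then -1 else 0) * r).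
  exact: wnormD w0 (aM c) (wnormZ _ (wnorm_coord N false r0')).
have hM' c : wnorm_le N (polydisc_weight r r) (h c) (M + r).
  apply: wnorm_leW (hM c); rewrite lerD2l; case: c; first by rewrite absvN absv1 mul1r.
  by rewrite absv0 mul0r.
apply: (prepared_normal_form r0 hM').
- by move=> c; rewrite /h a00 /snd_series /= mulr0 addr0.
- by move=> c; rewrite /h a01 /snd_series /= mulr1; case: c; rewrite ?subrr ?addr0.
have nearr : \forall p \near (0 : 'rV[K]_2), N `|p| <= r.
  by apply/(near_absvP N); exists r => // p; rewrite subr0.
apply: filterS2 YE nearr => p -> pr.
have px : N (cx p) <= r := le_trans (absv_entry N p ord0 ord0) pr.
have py : N (cy p) <= r := le_trans (absv_entry N p ord0 ord_max) pr.
have hv c : series_val N (h c) (cx p) (cy p) =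
    series_val N (a c) (cx p) (cy p) + (if c then -1 else 0) * cy p.
  apply: series_valE; apply: has_valD (series_valP (aM c) px py) (has_valZ _ _).
  exact: (has_val_coord N false).
by rewrite /series_map !hv mulN1r mul0r addr0 addrC subrK.
Qed.

End linear_change.

(** * The real and the complex numbers *)

Section instances.
Variable R : realType.

Lemma real_absv_complete (u : nat -> R) :
  (forall e, 0 < e -> exists n0, forall m n, (n0 <= m)%N -> (n0 <= n)%N ->
     `|u m - u n| <= e) ->
  exists l, forall e, 0 < e -> exists n0, forall n, (n0 <= n)%N -> `|u n - l| <= e.
Proof.
move=> cauchy_u.
have : cvgn u.
  apply/cauchy_cvgP/cauchyP => e e0.
  have e2 : 0 < e / 2 by rewrite divr_gt0.
  have [n0 un0] := cauchy_u _ e2.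
  exists (u n0); exists n0 => // n n0n.
  rewrite /= /ball_ /=; apply: (@le_lt_trans _ _ (e / 2)); first exact: un0.
  by rewrite ltr_pdivrMr // ltr_pMr // ltr1n.
move=> /cvg_ex[l /cvgrPdist_le ul]; exists l => e e0.
have [n0 _ n0P] := ul e e0; exists n0 => n n0n.
by rewrite distrC; exact: n0P.
Qed.

Definition real_abs_field : abs_field R R :=
  @AbsField R R Num.norm idfun (fun=> erefl) (fun _ _ => erefl) real_absv_complete.

Definition complex_absv (z : R[i]) : R := Num.sqrt (complex.Re z ^+ 2 + complex.Im z ^+ 2).

Lemma complex_absv_ge (z : R[i]) :
  `|complex.Re z| <= complex_absv z /\ `|complex.Im z| <= complex_absv z.
Proof.
by rewrite -!sqrtr_sqr /complex_absv; split; apply: ler_wsqrtr;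
  rewrite ?lerDl ?lerDr sqr_ge0.
Qed.

Lemma complex_absv_le (z : R[i]) :
  complex_absv z <= `|complex.Re z| + `|complex.Im z|.
Proof.
rewrite -[leRHS]ger0_norm ?addr_ge0 // -sqrtr_sqr /complex_absv; apply: ler_wsqrtr.
by rewrite sqrrD !real_normK ?num_real // lerD2r lerDl mulrn_wge0 // mulr_ge0.
Qed.

Lemma complex_absv_complete (u : nat -> R[i]) :
  (forall e, 0 < e -> exists n0, forall m n, (n0 <= m)%N -> (n0 <= n)%N ->
     complex_absv (u m - u n) <= e) ->
  exists l, forall e, 0 < e -> exists n0, forall n, (n0 <= n)%N ->
     complex_absv (u n - l) <= e.
Proof.
move=> cauchy_u.
have ReB (x y : R[i]) : complex.Re (x - y) = complex.Re x - complex.Re y.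
  by case: x; case: y.
have ImB (x y : R[i]) : complex.Im (x - y) = complex.Im x - complex.Im y.
  by case: x; case: y.
have [e e0|a ua] := @real_absv_complete (fun n => complex.Re (u n)).
  have [n0 un0] := cauchy_u e e0; exists n0 => m n mn nn; rewrite -ReB.
  exact: le_trans (complex_absv_ge _).1 (un0 m n mn nn).
have [e e0|b ub] := @real_absv_complete (fun n => complex.Im (u n)).
  have [n0 un0] := cauchy_u e e0; exists n0 => m n mn nn; rewrite -ImB.
  exact: le_trans (complex_absv_ge _).2 (un0 m n mn nn).
exists (Complex a b) => e e0; have e2 : 0 < e / 2 by rewrite divr_gt0.
have [n1 an1] := ua _ e2; have [n2 bn2] := ub _ e2.
exists (maxn n1 n2) => n; rewrite geq_max => /andP[n1n n2n].
apply: le_trans (complex_absv_le _) _; rewrite ReB ImB /= (splitr e).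
by apply: lerD; [exact: an1|exact: bn2].
Qed.

Lemma real_complex_le : {mono (real_complex R) : a b / a <= b}.
Proof. by move=> a b; rewrite lecR. Qed.

Definition complex_abs_field : abs_field R R[i] :=
  @AbsField R R[i] complex_absv (real_complex R) (@normc_def R) real_complex_le
    complex_absv_complete.

End instances.

Theorem theorem4 (R : realType) :
  (forall X : 'rV[R]_2 -> 'rV[R]_2,
     analytic_map_germ X -> X 0 = 0 -> ~ radial_linear_part X ->
     has_normal_form X) /\
  (forall X : 'rV[R[i]]_2 -> 'rV[R[i]]_2,
     analytic_map_germ X -> X 0 = 0 -> ~ radial_linear_part X ->
     has_normal_form X).
Proof.
by split=> X; [apply: (normal_form (real_abs_field R))|
               apply: (normal_form (complex_abs_field R))].
Qed.
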